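(* Let $H$ be a finite-dimensional Hopf algebra and regard $H^*$ as a braided-commutative algebra in the category of right Drinfeld–Yetter modules over $H$ by $a\triangleleft h=\langle a_{(1)},h\rangle a_{(2)}$ and the coaction determined by $(\mathrm{id}\otimes b)(\Delta_Ra)=b_{(1)}a\,S(b_{(2)})$ for $a,b\in H^*$, $h\in H$. Then $Z^2_\triangleleft(H,H^* )$ can be identified with the set of convolution-invertible maps $\delta:H\otimes H\to k$ that respect the unit in the sense $\delta(h,1)=\varepsilon(h)=\delta(1,h)$ and obey (1) $\delta(h_{(1)},g_{(1)})\,g_{(2)}h_{(2)}=g_{(1)}h_{(1)}\,\delta(h_{(2)},g_{(2)})$; (2) $\delta(f_{(1)},h_{(1)})\,\delta(h_{(2)}f_{(2)},g_{(1)})\,\delta^{-1}(f_{(3)},g_{(2)}h_{(3)})\,h_{(4)}f_{(4)}=\delta(f_{(6)},h_{(6)})\,\delta\big(h_{(7)}f_{(7)},\,g_{(1)}h_{(1)}f_{(1)}(Sf_{(5)})(Sh_{(5)})\big)\,\delta^{-1}\big(f_{(8)},\,g_{(2)}h_{(2)}f_{(2)}(Sf_{(4)})(Sh_{(4)})h_{(8)}\big)\,h_{(3)}f_{(3)}$; (3) $\delta(f_{(1)},h_{(1)})\,\delta(h_{(2)}f_{(2)},g_{(1)})\,\delta^{-1}(f_{(3)},g_{(2)}h_{(3)})\,f_{(4)}=\delta\big(f_{(8)},h_{(1)}f_{(1)}Sf_{(7)}\big)\,\delta\big(h_{(2)}f_{(2)}(Sf_{(6)})f_{(9)},g_{(1)}\big)\,\delta^{-1}\big(f_{(10)},g_{(2)}h_{(3)}f_{(3)}(Sf_{(5)})\big)\,f_{(4)}$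 for all $f,g,h\in H$. The 2-cocycle corresponding to $\delta$ is $$\gamma_\delta(g,h)=\langle\delta^{2}\,\delta^{1'}{}_{(1)}\,\bar\delta^{2}{}_{(2)},g\rangle\,\langle\delta^{2'}\,\bar\delta^{2}{}_{(1)},h\rangle\,\delta^{1}\,\delta^{1'}{}_{(2)}\,\bar\delta^{1},$$ where $\delta=\delta^1\otimes\delta^2=\delta^{1'}\otimes\delta^{2'}$ (two copies) and its inverse $\delta^{-1}=\bar\delta^1\otimes\bar\delta^2$ are viewed in $H^*\otimes H^*$ (summations understood).
   Context: Everything is over a field $k$. $H^*$ is the dual Hopf algebra, with $\langle ab,h\rangle=\langle a,h_{(1)}\rangle\langle b,h_{(2)}\rangle$ and $\langle a,hg\rangle=\langle a_{(1)},h\rangle\langle a_{(2)},g\rangle$. Convolution on maps $H\otimes H\to k$ is $(\delta\ast\delta')(h,g)=\delta(h_{(1)},g_{(1)})\delta'(h_{(2)},g_{(2)})$, i.e. the product of $H^*\otimes H^*$, and $\delta^{-1}$ is the convolution inverse. A right Drinfeld–Yetter module over $H$ is a vector space $B$ with a right $H$-action $\triangleleft$ and a right $H$-coaction $\Delta_Rb=b_{(0)}\otimes b_{(1)}$ such that $(b\triangleleft h_{(2)})_{(0)}\otimes h_{(1)}(b\triangleleft h_{(2)})_{(1)}=b_{(0)}\triangleleft h_{(1)}\otimes b_{(1)}h_{(2)}$. A braided-commutative algebra in this category is such a $B$ that is an algebra which is a right $H$-module algebra and a right $H$-comodule algebra with $ab=b_{(0)}(a\triangleleft b_{(1)})$ for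 all $a,b$. For such $B$, $Z^2_\triangleleft(H,B)$ is the set of convolution-invertible linear maps $\gamma:H\otimes H\to B$ such that for all $f,g,h\in H$, $b\in B$: $\gamma(h,1)=\gamma(1,h)=\varepsilon(h)1$; $(\gamma(g_{(1)},f_{(1)})\triangleleft h_{(1)})\gamma(h_{(2)},f_{(2)}g_{(2)})=\gamma(h_{(1)},g_{(1)})\gamma(g_{(2)}h_{(2)},f)$; $\gamma(h_{(1)},g_{(1)})(b\triangleleft(g_{(2)}h_{(2)}))=(b\triangleleft(g_{(1)}h_{(1)}))\gamma(h_{(2)},g_{(2)})$; $\gamma(h_{(1)},g)(b\triangleleft h_{(2)})=(b_{(0)}\triangleleft h_{(1)})\gamma(h_{(2)},gb_{(1)})$; and $b_{(0)}\gamma(hb_{(1)},g)=\gamma(h,g)b$. *)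

(* Defs.v *)
From HB Require Import structures.
From mathcomp Require Import all_boot all_order all_algebra all_field.

Set Implicit Arguments.
Unset Strict Implicit.
Unset Printing Implicit Defensive.

Import GRing.Theory.
Local Open Scope ring_scope.

(* U (x) V for finite-dimensional V, as the families of coefficients in U over *)
(* the chosen basis of V.                                                      *)
Record tensor (k : fieldType) (U : lmodType k) (V : vectType k) : Type :=
  Tensor { tval : {ffun 'I_(\dim {:V}) -> U} }.

Notation "U ⊗ V" := (tensor U V) (at level 40, left associativity) : type_scope.

Section TensorLmodule.
Variables (k : fieldType) (U : lmodType k) (V : vectType k).
Local Notation T := (U ⊗ V)%type.
Implicit Types s t r : T.

HB.instance Definition _ := [isNew for @tval k U V].
HB.instance Definition _ := [Choice of T by <:].

Definition tensor_add s t : T := Tensor (tval s + tval t).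
Definition tensor_opp s : T := Tensor (- tval s).
Definition tensor_scale (a : k) s : T := Tensor (a *: tval s).

Fact tensor_addA : associative tensor_add.
Proof. by move=> s t r; apply: val_inj; apply: addrA. Qed.
Fact tensor_addC : commutative tensor_add.
Proof. by move=> s t; apply: val_inj; apply: addrC. Qed.
Fact tensor_add0 : left_id (Tensor 0) tensor_add.
Proof. by move=> s; apply: val_inj; apply: add0r. Qed.
Fact tensor_addN : left_inverse (Tensor 0) tensor_opp tensor_add.
Proof. by move=> s; apply: val_inj; apply: addNr. Qed.
HB.instance Definition _ := GRing.isZmodule.Build T
  tensor_addA tensor_addC tensor_add0 tensor_addN.

Fact tensor_scaleA a b t :
  tensor_scale a (tensor_scale b t) = tensor_scale (a * b) t.
Proof. by apply: val_inj; apply: scalerA. Qed.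
Fact tensor_scale1 : left_id 1 tensor_scale.
Proof. by move=> t; apply: val_inj; apply: scale1r. Qed.
Fact tensor_scaleDr : right_distributive tensor_scale +%R.
Proof. by move=> a s t; apply: val_inj; apply: scalerDr. Qed.
Fact tensor_scaleDl t : {morph tensor_scale^~ t : a b / a + b}.
Proof. by move=> a b; apply: val_inj; apply: scalerDl. Qed.
HB.instance Definition _ := GRing.Zmodule_isLmodule.Build k T
  tensor_scaleA tensor_scale1 tensor_scaleDr tensor_scaleDl.

Fact tval_linear : linear (@tval k U V). Proof. by []. Qed.
HB.instance Definition _ := GRing.isLinear.Build k T _ _ (@tval k U V) tval_linear.

End TensorLmodule.

Section TensorVector.
Import VectorInternalTheory.
Variables (k : fieldType) (U V : vectType k).

Fact tensor_vect_iso :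
  Vector.axiom (dim {ffun 'I_(\dim {:V}) -> U}) (U ⊗ V)%type.
Proof.
exists (fun t => v2r (tval t)) => [a s t|]; first by rewrite !linearP.
exists (fun r => Tensor (r2v r)) => [t|r]; last exact: r2vK.
by apply: val_inj; apply: v2rK.
Qed.
HB.instance Definition _ :=
  Lmodule_hasFinDim.Build k (U ⊗ V)%type tensor_vect_iso.

End TensorVector.

Section Tensor.
Variables (k : fieldType) (U : lmodType k) (V : vectType k).

Definition tbase (i : 'I_(\dim {:V})) : V := (vbasis {:V})`_i.
Definition tcoord (i : 'I_(\dim {:V})) (v : V) : k := coord (vbasis {:V}) i v.

Definition tens (u : U) (v : V) : (U ⊗ V)%type := Tensor [ffun i => tcoord i v *: u].

(* For bilinear F, the image of t under the linear map u (x) v |-> F u v.      *)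
Definition tsum (W : lmodType k) (t : (U ⊗ V)%type) (F : U -> V -> W) : W :=
  \sum_i F (tval t i) (tbase i).

End Tensor.

Notation "u ⊗ v" := (tens u v) (at level 40, left associativity) : ring_scope.
Notation "'\T_' ( x , y <- t ) E" := (tsum t (fun x y => E))
  (at level 41, x name, y name, t at level 99, E at level 41,
   format "'\T_' ( x ,  y  <-  t )  E") : ring_scope.

(* lin f: f is linear; a predicate on bare functions.                          *)
Definition lin (k : fieldType) (U V : lmodType k) (f : U -> V) : Prop :=
  forall a u v, f (a *: u + v) = a *: f u + f v.

Section Lin.
Variable k : fieldType.
Implicit Types U V W : lmodType k.

Lemma linE U V (f : {linear U -> V}) : lin f.
Proof. by move=> a u v; rewrite linearP. Qed.

Lemma lin_scalar U (f : {scalar U}) : lin (V := k^o) f.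
Proof. by move=> a u v; rewrite linearP. Qed.

Lemma linZ U V (f : U -> V) : lin f -> forall a u, f (a *: u) = a *: f u.
Proof.
move=> hf; have f0 : f 0 = 0.
  by apply: (@addIr _ (f 0)); rewrite add0r -{1}(scale1r (f 0)) -hf scale1r addr0.
by move=> a u; rewrite -[a *: u]addr0 hf f0 addr0.
Qed.

Lemma linD U V (f : U -> V) : lin f -> {morph f : u v / u + v}.
Proof. by move=> hf u v; rewrite -[u in LHS]scale1r hf scale1r. Qed.

Lemma lin0 U V (f : U -> V) : lin f -> f 0 = 0.
Proof. by move=> hf; rewrite -(scale0r 0) linZ // scale0r. Qed.

Lemma lin_sum U V (f : U -> V) : lin f ->
  forall I (r : seq I) (P : pred I) (F : I -> U),
  f (\sum_(i <- r | P i) F i) = \sum_(i <- r | P i) f (F i).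
Proof. by move=> hf I r P F; apply: (big_morph f (linD hf) (lin0 hf)). Qed.

Lemma lin_id U : lin (fun u : U => u). Proof. by []. Qed.

Lemma lin_comp U V W (g : V -> W) (f : U -> V) :
  lin g -> lin f -> lin (fun x => g (f x)).
Proof. by move=> hg hf a u v; rewrite hf hg. Qed.

Lemma lin_scale U V (f : U -> k) (v : V) :
  lin (V := k^o) f -> lin (fun x => f x *: v).
Proof. by move=> hf a u w; rewrite hf scalerDl -scalerA. Qed.

Lemma lin_scaler U V (f : U -> V) (c : k) : lin f -> lin (fun x => c *: f x).
Proof. by move=> hf a u w; rewrite hf scalerDr !scalerA mulrC. Qed.

Lemma lin_mull U (A : algType k) (f : U -> A) (c : A) :
  lin f -> lin (fun x => f x * c).
Proof. by move=> hf a u w; rewrite hf mulrDl scalerAl. Qed.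

Lemma lin_mulr U (A : algType k) (f : U -> A) (c : A) :
  lin f -> lin (fun x => c * f x).
Proof. by move=> hf a u w; rewrite hf mulrDr scalerAr. Qed.

Lemma lin_kmull U (f : U -> k) (c : k) :
  lin (V := k^o) f -> lin (V := k^o) (fun x => f x * c).
Proof. by move=> hf; apply: (@lin_mull U k^o). Qed.

Lemma lin_kmulr U (f : U -> k) (c : k) :
  lin (V := k^o) f -> lin (V := k^o) (fun x => c * f x).
Proof. by move=> hf; apply: (@lin_mulr U k^o). Qed.

Lemma lin_tsum_body U (X : lmodType k) (Y : vectType k) W (t : (X ⊗ Y)%type)
    (F : U -> X -> Y -> W) :
  (forall x y, lin (fun u => F u x y)) -> lin (fun u => tsum t (F u)).
Proof.
move=> hF a u v; rewrite /tsum scaler_sumr -big_split /=.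
by apply: eq_bigr => i _; rewrite hF.
Qed.

Lemma lin_tsum U (X : lmodType k) (Y : vectType k) W (g : U -> (X ⊗ Y)%type)
    (F : X -> Y -> W) :
  lin g -> (forall y, lin (F^~ y)) -> lin (fun u => tsum (g u) F).
Proof.
move=> hg hF a u v; rewrite hg /tsum scaler_sumr -big_split /=.
by apply: eq_bigr => i _; rewrite !ffunE hF.
Qed.

Lemma lin_tensl U (X : lmodType k) (Y : vectType k) (f : U -> X) (y : Y) :
  lin f -> lin (fun u => f u ⊗ y).
Proof.
move=> hf a u v; apply: val_inj; apply/ffunP => i; rewrite !ffunE hf scalerDr !scalerA.
by rewrite [a * _]mulrC.
Qed.

Lemma tcoord_lin (V : vectType k) i : lin (V := k^o) (@tcoord k V i).
Proof. by move=> a u v; rewrite /tcoord linearP. Qed.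

Lemma lin_tensr U (X : lmodType k) (Y : vectType k) (f : U -> Y) (x : X) :
  lin f -> lin (fun u => x ⊗ f u).
Proof.
move=> hf a u v; apply: val_inj; apply/ffunP => i.
by rewrite !ffunE /tcoord hf linearP scalerDl scalerA.
Qed.

End Lin.

Section TensorTheory.
Variables (k : fieldType) (U : lmodType k) (V : vectType k).
Implicit Types W : lmodType k.

Lemma tbase_sum (v : V) : v = \sum_i tcoord i v *: tbase i.
Proof. exact: coord_vbasis (memvf v). Qed.

Lemma tcoord_tbase i j : tcoord i (@tbase k V j) = (j == i)%:R.
Proof.
rewrite /tcoord /tbase coord_free; last exact: basis_free (vbasisP _).
by rewrite eq_sym.
Qed.

Lemma tsum_tens W (F : U -> V -> W) u v :
  (forall y, lin (F^~ y)) -> (forall x, lin (F x)) -> tsum (u ⊗ v) F = F u v.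
Proof.
move=> hl hr; rewrite [v in RHS]tbase_sum lin_sum // /tsum.
by apply: eq_bigr => i _; rewrite ffunE (linZ (hl _)) (linZ (hr _)).
Qed.

Lemma tsum_eta (t : (U ⊗ V)%type) : tsum t (@tens k U V) = t.
Proof.
apply: val_inj; apply/ffunP => i; rewrite /= linear_sum sum_ffunE (bigD1 i) //= ffunE tcoord_tbase eqxx scale1r.
rewrite big1 ?addr0 // => j ji; rewrite ffunE tcoord_tbase.
by rewrite (negPf ji) scale0r.
Qed.

Lemma eq_tsum W (F G : U -> V -> W) t :
  (forall x y, F x y = G x y) -> tsum t F = tsum t G.
Proof. by move=> FG; apply: eq_bigr => i _. Qed.

Lemma lin_tsumE W W' (f : W -> W') (F : U -> V -> W) t :
  lin f -> f (tsum t F) = \T_(x, y <- t) f (F x y).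
Proof. by move=> hf; rewrite /tsum lin_sum. Qed.

Lemma tsum_exchange (X : lmodType k) (Y : vectType k) W
    (F : U -> V -> X -> Y -> W) (t : (U ⊗ V)%type) (s : (X ⊗ Y)%type) :
  \T_(x, y <- t) \T_(z, w <- s) F x y z w
    = \T_(z, w <- s) \T_(x, y <- t) F x y z w.
Proof. exact: exchange_big. Qed.

End TensorTheory.

(* The counit being nonzero only excludes the zero coalgebra; it makes the     *)
(* dual algebra nontrivial, as MathComp requires.                              *)
HB.mixin Record isNzCoalgebra (k : fieldType) C of Vector k C := {
  coprod : {linear C -> (C ⊗ C)%type};
  counit : {scalar C};
  coprodA : forall c : C,
    \T_(x, y <- coprod c) \T_(x1, x2 <- coprod x) (x1 ⊗ x2) ⊗ y
      = \T_(x, y <- coprod c) \T_(y1, y2 <- coprod y) (x ⊗ y1) ⊗ y2;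
  counitl : forall c : C, \T_(x, y <- coprod c) (counit x *: y) = c;
  counitr : forall c : C, \T_(x, y <- coprod c) (counit y *: x) = c;
  counit_neq0 : exists c : C, counit c != 0 }.

#[short(type="nzCoalgType")]
HB.structure Definition NzCoalgebra (k : fieldType) :=
  { C of isNzCoalgebra k C & Vector k C }.

Section Sweedler.
Variables (k : fieldType) (C : nzCoalgType k) (W : lmodType k).

Fixpoint nfun (n : nat) : Type := if n is n'.+1 then C -> nfun n' else W.

(* For n-linear F, the image of the iterated coproduct of c with n legs under  *)
(* c1 (x) ... (x) cn |-> F c1 ... cn.                                          *)
Fixpoint sweedler (n : nat) : C -> nfun n -> W :=
  match n return C -> nfun n -> W with
  | 0 => fun c F => counit c *: F
  | n'.+1 =>
    match n' return (C -> nfun n' -> W) -> C -> nfun n'.+1 -> W with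
    | 0 => fun _ c F => F c
    | _.+1 => fun sw c F => \T_(c1, c' <- coprod c) sw c' (F c1)
    end (@sweedler n')
  end.

End Sweedler.
Arguments nfun {k} C W n.
Arguments sweedler {k C W} n c F.

(* \Sw[n]_(c1 c2 .. cn <- c) E(c1, ..., cn), with the sum understood.          *)
Notation "'\Sw[' n ]_( x .. y <- c ) E" :=
  (sweedler n%N c (fun x => .. (fun y => E) ..))
  (at level 41, n at level 99, x closed binder, y closed binder,
   c at level 99, E at level 41,
   format "'\Sw[' n ]_( x  ..  y  <-  c )  E") : ring_scope.

Ltac lin_hook := fail.

Ltac lin_tac :=
  solve [ exact: linE
    | exact: lin_scalar
    | exact: lin_id
    | exact: tcoord_lin
    | assumption
    | lin_hook
    | apply: lin_tensl; lin_tac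
    | apply: lin_tensr; lin_tac
    | apply: lin_kmull; lin_tac
    | apply: lin_kmulr; lin_tac
    | apply: lin_mull; lin_tac
    | apply: lin_mulr; lin_tac
    | apply: lin_scale; lin_tac
    | apply: lin_scaler; lin_tac
    | apply: lin_tsum_body => ? ?; lin_tac
    | apply: lin_tsum; [lin_tac | move=> ?; lin_tac]
    | apply: (lin_comp (linE _)); lin_tac
    | apply: (lin_comp (lin_scalar _)); lin_tac
    | match goal with H : _ |- _ => apply: H; lin_tac end ].

Section CoalgebraTheory.
Variables (k : fieldType) (C : nzCoalgType k) (W : lmodType k).

Lemma coprodA_fun (c : C) (F : C -> C -> C -> W) :
  (forall y z, lin (fun x => F x y z)) -> (forall x z, lin (fun y => F x y z)) ->
  (forall x y, lin (F x y)) ->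
  \T_(x, y <- coprod c) \T_(x1, x2 <- coprod x) F x1 x2 y
    = \T_(x, y <- coprod c) \T_(y1, y2 <- coprod y) F x y1 y2.
Proof.
move=> h1 h2 h3.
pose L (t : (C ⊗ C ⊗ C)%type) := \T_(u, z <- t) \T_(x, y <- u) F x y z.
have hL : lin L by rewrite /L; lin_tac.
have LE x y z : L ((x ⊗ y) ⊗ z) = F x y z.
  rewrite /L tsum_tens; [|by move=> ?; lin_tac|by move=> ?; lin_tac].
  by rewrite tsum_tens // => ?; lin_tac.
have := congr1 L (coprodA c); rewrite !(lin_tsumE _ _ hL).
under eq_tsum => x y do (rewrite (lin_tsumE _ _ hL); under eq_tsum do rewrite LE).
move=> ->.
by apply: eq_tsum => x y; rewrite (lin_tsumE _ _ hL); apply: eq_tsum => *; rewrite LE.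
Qed.

End CoalgebraTheory.

Section TensorCoalgebra.
Variables (k : fieldType) (C D : nzCoalgType k).

(* (c (x) d)_(1) (x) (c (x) d)_(2) = (c_(1) (x) d_(1)) (x) (c_(2) (x) d_(2))   *)
Definition tensor_coprod (t : (C ⊗ D)%type) : ((C ⊗ D) ⊗ (C ⊗ D))%type :=
  \T_(c, d <- t) \T_(c1, c2 <- coprod c) \T_(d1, d2 <- coprod d)
    (c1 ⊗ d1) ⊗ (c2 ⊗ d2).

Definition tensor_counit (t : (C ⊗ D)%type) : k :=
  \T_(c, d <- t) (counit c * counit d : k^o).

Lemma tensor_coprod_lin : lin tensor_coprod.
Proof. by rewrite /tensor_coprod; lin_tac. Qed.

Lemma tensor_counit_lin : lin (V := k^o) tensor_counit.
Proof. by rewrite /tensor_counit; lin_tac. Qed.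

HB.instance Definition _ :=
  GRing.isLinear.Build k _ _ _ tensor_coprod tensor_coprod_lin.
HB.instance Definition _ :=
  GRing.isLinear.Build k _ k *%R tensor_counit tensor_counit_lin.

Lemma tensor_coprodE c d : tensor_coprod (c ⊗ d) =
  \T_(c1, c2 <- coprod c) \T_(d1, d2 <- coprod d) (c1 ⊗ d1) ⊗ (c2 ⊗ d2).
Proof. by rewrite /tensor_coprod tsum_tens // => ?; lin_tac. Qed.

Lemma tensor_counitE c d : tensor_counit (c ⊗ d) = counit c * counit d.
Proof. by rewrite /tensor_counit tsum_tens // => ?; lin_tac. Qed.

Lemma tensor_lin_ext (X : lmodType k) (Y : vectType k) (W : lmodType k)
    (f g : (X ⊗ Y)%type -> W) :
  lin f -> lin g -> (forall x y, f (x ⊗ y) = g (x ⊗ y)) -> f =1 g.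
Proof.
move=> hf hg fg t; rewrite -[t]tsum_eta !lin_tsumE //.
by apply: eq_tsum => x y; apply: fg.
Qed.

Fact tensor_counitl (t : (C ⊗ D)%type) :
  \T_(x, y <- tensor_coprod t) (tensor_counit x *: y) = t.
Proof.
move: t; apply: tensor_lin_ext => [||c d]; [by lin_tac|exact: lin_id|].
rewrite tensor_coprodE (lin_tsumE _ _ (f := fun s => tsum s _)); last by lin_tac.
transitivity (\T_(c1, c2 <- coprod c) \T_(d1, d2 <- coprod d)
  ((counit c1 *: c2) ⊗ (counit d1 *: d2))).
  apply: eq_tsum => c1 c2.
  rewrite (lin_tsumE _ _ (f := fun s => tsum s _)); last by lin_tac.
  apply: eq_tsum => d1 d2; rewrite tsum_tens; [|by move=> ?; lin_tac|by move=> ?; lin_tac].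
  rewrite tensor_counitE (linZ (f := fun u => u ⊗ _)); last by lin_tac.
  by rewrite (linZ (f := fun u => _ ⊗ u)) ?scalerA //; lin_tac.
rewrite -[c in RHS]counitl -[d in RHS]counitl.
rewrite (lin_tsumE _ _ (f := fun s => s ⊗ _)); last by lin_tac.
apply: eq_tsum => c1 c2.
by rewrite (lin_tsumE _ _ (f := fun s => _ ⊗ s)) //; lin_tac.
Qed.

Fact tensor_counitr (t : (C ⊗ D)%type) :
  \T_(x, y <- tensor_coprod t) (tensor_counit y *: x) = t.
Proof.
move: t; apply: tensor_lin_ext => [||c d]; [by lin_tac|exact: lin_id|].
rewrite tensor_coprodE (lin_tsumE _ _ (f := fun s => tsum s _)); last by lin_tac.
transitivity (\T_(c1, c2 <- coprod c) \T_(d1, d2 <- coprod d)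
  ((counit c2 *: c1) ⊗ (counit d2 *: d1))).
  apply: eq_tsum => c1 c2.
  rewrite (lin_tsumE _ _ (f := fun s => tsum s _)); last by lin_tac.
  apply: eq_tsum => d1 d2; rewrite tsum_tens; [|by move=> ?; lin_tac|by move=> ?; lin_tac].
  rewrite tensor_counitE (linZ (f := fun u => u ⊗ _)); last by lin_tac.
  by rewrite (linZ (f := fun u => _ ⊗ u)) ?scalerA //; lin_tac.
rewrite -[c in RHS]counitr -[d in RHS]counitr.
rewrite (lin_tsumE _ _ (f := fun s => s ⊗ _)); last by lin_tac.
apply: eq_tsum => c1 c2.
by rewrite (lin_tsumE _ _ (f := fun s => _ ⊗ s)) //; lin_tac.
Qed.

Fact tensor_coprodA (t : (C ⊗ D)%type) :
  \T_(x, y <- tensor_coprod t) \T_(x1, x2 <- tensor_coprod x) (x1 ⊗ x2) ⊗ y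
    = \T_(x, y <- tensor_coprod t) \T_(y1, y2 <- tensor_coprod y) (x ⊗ y1) ⊗ y2.
Proof.
move: t; apply: tensor_lin_ext => [||c d]; [by lin_tac|by lin_tac|].
pose G (W : lmodType k) (F : C -> C -> D -> D -> W) :=
  \T_(c1, c2 <- coprod c) \T_(d1, d2 <- coprod d) F c1 c2 d1 d2.
have GE (W : lmodType k) (F : (C ⊗ D)%type -> (C ⊗ D)%type -> W) :
    (forall y, lin (F^~ y)) -> (forall x, lin (F x)) ->
    tsum (tensor_coprod (c ⊗ d)) F
      = G W (fun c1 c2 d1 d2 => F (c1 ⊗ d1) (c2 ⊗ d2)).
  move=> h1 h2; rewrite tensor_coprodE (lin_tsumE _ _ (f := fun s => tsum s _));
    last by lin_tac.
  apply: eq_tsum => c1 c2.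
  rewrite (lin_tsumE _ _ (f := fun s => tsum s _)); last by lin_tac.
  by apply: eq_tsum => d1 d2; rewrite tsum_tens.
rewrite !GE /G; try by move=> ?; lin_tac.
transitivity (\T_(c1, c2 <- coprod c) \T_(x1, x2 <- coprod c1)
  \T_(d1, d2 <- coprod d) \T_(y1, y2 <- coprod d1)
    (((x1 ⊗ y1) ⊗ (x2 ⊗ y2)) ⊗ (c2 ⊗ d2))).
  apply: eq_tsum => c1 c2; rewrite tsum_exchange; apply: eq_tsum => d1 d2.
  rewrite tensor_coprodE (lin_tsumE _ _ (f := fun s => tsum s _)); last by lin_tac.
  apply: eq_tsum => x1 x2.
  rewrite (lin_tsumE _ _ (f := fun s => tsum s _)); last by lin_tac.
  by apply: eq_tsum => y1 y2; rewrite tsum_tens // => ?; lin_tac.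
rewrite (coprodA_fun c (F := fun x1 x2 c2 => \T_(d1, d2 <- coprod d)
  \T_(y1, y2 <- coprod d1) (((x1 ⊗ y1) ⊗ (x2 ⊗ y2)) ⊗ (c2 ⊗ d2))));
  try by move=> *; lin_tac.
apply: eq_tsum => c1 c2.
transitivity (\T_(d1, d2 <- coprod d) \T_(x1, x2 <- coprod c2)
  \T_(y1, y2 <- coprod d2) (((c1 ⊗ d1) ⊗ (x1 ⊗ y1)) ⊗ (x2 ⊗ y2))).
  rewrite [RHS]tsum_exchange; apply: eq_tsum => x1 x2.
  by apply: (coprodA_fun d (F := fun y1 y2 y3 =>
    ((c1 ⊗ y1) ⊗ (x1 ⊗ y2)) ⊗ (x2 ⊗ y3))) => *; lin_tac.
apply: eq_tsum => d1 d2.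
rewrite tensor_coprodE (lin_tsumE _ _ (f := fun s => tsum s _)); last by lin_tac.
apply: eq_tsum => x1 x2.
rewrite (lin_tsumE _ _ (f := fun s => tsum s _)); last by lin_tac.
by apply: eq_tsum => y1 y2; rewrite tsum_tens // => ?; lin_tac.
Qed.

Fact tensor_counit_neq0 : exists t : (C ⊗ D)%type, tensor_counit t != 0.
Proof.
have [c nc] := @counit_neq0 _ C; have [d nd] := @counit_neq0 _ D.
by exists (c ⊗ d); rewrite tensor_counitE mulf_neq0.
Qed.

HB.instance Definition _ := isNzCoalgebra.Build k (C ⊗ D)%type
  tensor_coprodA tensor_counitl tensor_counitr tensor_counit_neq0.

End TensorCoalgebra.
Section Convolution.
Variables (k : fieldType) (C : nzCoalgType k) (A : algType k).
Implicit Types f g : C -> A.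

Definition conv f g (c : C) : A := \T_(c1, c2 <- coprod c) (f c1 * g c2).

Definition conv_unit (c : C) : A := counit c *: 1.

Definition conv_invertible (f : {linear C -> A}) : Prop :=
  exists g : {linear C -> A}, conv f g =1 conv_unit /\ conv g f =1 conv_unit.

Lemma conv_lin f g : lin f -> lin (conv f g).
Proof. by move=> hf; rewrite /conv; lin_tac. Qed.

Lemma conv_unit_lin : lin conv_unit.
Proof. by rewrite /conv_unit; lin_tac. Qed.

Lemma eq_conv f f' g g' : f =1 f' -> g =1 g' -> conv f g =1 conv f' g'.
Proof. by move=> ff gg c; apply: eq_tsum => x y; rewrite ff gg. Qed.

Lemma convA f g h : lin f -> lin g -> lin h ->
  conv f (conv g h) =1 conv (conv f g) h.
Proof.
move=> hf hg hh c; rewrite /conv; symmetry.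
under eq_tsum => x y do
  (rewrite (lin_tsumE _ _ (f := fun s => s * _)); last by lin_tac).
rewrite (coprodA_fun c (F := fun x y z => f x * g y * h z)); try by move=> *; lin_tac.
apply: eq_tsum => x y; rewrite (lin_tsumE _ _ (f := fun s => _ * s)); last by lin_tac.
by apply: eq_tsum => *; rewrite mulrA.
Qed.

Lemma conv1l f : lin f -> conv conv_unit f =1 f.
Proof.
move=> hf c; rewrite -[c in RHS]counitl (lin_tsumE _ _ hf).
by apply: eq_tsum => x y; rewrite (linZ hf) /conv_unit -scalerAl mul1r.
Qed.

Lemma conv1r f : lin f -> conv f conv_unit =1 f.
Proof.
move=> hf c; rewrite -[c in RHS]counitr (lin_tsumE _ _ hf).
by apply: eq_tsum => x y; rewrite (linZ hf) /conv_unit -scalerAr mulr1.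
Qed.

Lemma conv_inv_uniq f g g' : lin f -> lin g -> lin g' ->
  conv g f =1 conv_unit -> conv f g' =1 conv_unit -> g =1 g'.
Proof.
move=> hf hg hg' gf fg' c.
rewrite -(conv1r hg) -(conv1l hg') -(eq_conv (frefl g) fg') convA //.
exact: eq_conv.
Qed.

End Convolution.

Section TensorConvolution.
Variables (k : fieldType) (C D : nzCoalgType k) (A : algType k).

Lemma conv_tensE (f g : (C ⊗ D)%type -> A) c d : lin f -> lin g ->
  conv f g (c ⊗ d) = \T_(c1, c2 <- coprod c) \T_(d1, d2 <- coprod d)
    (f (c1 ⊗ d1) * g (c2 ⊗ d2)).
Proof.
move=> hf hg; rewrite /conv [coprod _]tensor_coprodE.
rewrite (lin_tsumE _ _ (f := fun s => tsum s _)); last by lin_tac.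
apply: eq_tsum => c1 c2.
rewrite (lin_tsumE _ _ (f := fun s => tsum s _)); last by lin_tac.
by apply: eq_tsum => d1 d2; rewrite tsum_tens // => ?; lin_tac.
Qed.

End TensorConvolution.

(* The dual C^* of a coalgebra; its product is convolution.                    *)
Record dual (k : fieldType) (C : nzCoalgType k) : Type :=
  Dual { dual_val : 'Hom(C, k^o) }.

(* <a, c>, with value in k rather than in the regular module k^o.              *)
Definition dual_ev (k : fieldType) (C : nzCoalgType k) (a : dual C) (c : C) : k :=
  dual_val a c.
Coercion dual_ev : dual >-> Funclass.

Section DualVector.
Variables (k : fieldType) (C : nzCoalgType k).
Implicit Types a b d : dual C.

HB.instance Definition _ := [isNew for @dual_val k C].
HB.instance Definition _ := [Choice of dual C by <:].

Definition dual_add a b : dual C := Dual (dual_val a + dual_val b).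
Definition dual_opp a : dual C := Dual (- dual_val a).
Definition dual_scale (x : k) a : dual C := Dual (x *: dual_val a).

Fact dual_addA : associative dual_add.
Proof. by move=> a b d; apply: val_inj; apply: addrA. Qed.
Fact dual_addC : commutative dual_add.
Proof. by move=> a b; apply: val_inj; apply: addrC. Qed.
Fact dual_add0 : left_id (Dual 0) dual_add.
Proof. by move=> a; apply: val_inj; apply: add0r. Qed.
Fact dual_addN : left_inverse (Dual 0) dual_opp dual_add.
Proof. by move=> a; apply: val_inj; apply: addNr. Qed.
HB.instance Definition _ := GRing.isZmodule.Build (dual C)
  dual_addA dual_addC dual_add0 dual_addN.

Fact dual_scaleA x y a : dual_scale x (dual_scale y a) = dual_scale (x * y) a.
Proof. by apply: val_inj; apply: scalerA. Qed.
Fact dual_scale1 : left_id 1 dual_scale.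
Proof. by move=> a; apply: val_inj; apply: scale1r. Qed.
Fact dual_scaleDr : right_distributive dual_scale +%R.
Proof. by move=> x a b; apply: val_inj; apply: scalerDr. Qed.
Fact dual_scaleDl a : {morph dual_scale^~ a : x y / x + y}.
Proof. by move=> x y; apply: val_inj; apply: scalerDl. Qed.
HB.instance Definition _ := GRing.Zmodule_isLmodule.Build k (dual C)
  dual_scaleA dual_scale1 dual_scaleDr dual_scaleDl.

Import VectorInternalTheory.

Fact dual_vect_iso : Vector.axiom (dim 'Hom(C, k^o)) (dual C).
Proof.
exists (fun a => v2r (dual_val a)) => [x a b|]; first by rewrite !linearP.
exists (fun r => Dual (r2v r)) => [a|r]; last exact: r2vK.
by apply: val_inj; apply: v2rK.
Qed.
HB.instance Definition _ := Lmodule_hasFinDim.Build k (dual C) dual_vect_iso.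

End DualVector.

Section DualAlgebra.
Variables (k : fieldType) (C : nzCoalgType k).
Implicit Types (a b : dual C) (c : C).

Fact dual_ev_scalar a : scalar (dual_ev a).
Proof. by move=> x u v; rewrite /dual_ev linearP. Qed.
HB.instance Definition _ a :=
  GRing.isLinear.Build k C k *%R (dual_ev a) (dual_ev_scalar a).

Lemma dualD a b c : (a + b) c = a c + b c.
Proof. by rewrite /dual_ev lfunE. Qed.

Lemma dualZ x a c : (x *: a) c = x * a c.
Proof. by rewrite /dual_ev lfunE. Qed.

Lemma dual0E c : (0 : dual C) c = 0.
Proof. by rewrite /dual_ev lfunE. Qed.

Lemma dual_sumE I (r : seq I) (P : pred I) (F : I -> dual C) c :
  (\sum_(i <- r | P i) F i) c = \sum_(i <- r | P i) F i c.
Proof.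
exact: (big_morph (fun a : dual C => a c) (fun a b => dualD a b c) (dual0E c)).
Qed.

Lemma dual_ev_lin (X : lmodType k) (f : X -> dual C) c :
  lin f -> lin (V := k^o) (fun x => f x c).
Proof. by move=> hf x u v; rewrite hf dualD dualZ. Qed.

Lemma dualP a b : (forall c, a c = b c) -> a = b.
Proof. by move=> ab; apply: val_inj; apply/lfunP => c; apply: ab. Qed.

Definition dual_of (f : C -> k) : dual C := Dual (linfun (f : C -> k^o)).

Lemma dual_ofE (f : C -> k) c : lin (V := k^o) f -> dual_of f c = f c.
Proof.
move=> hf; pose fl := GRing.isLinear.Build k C k^o _ f hf.
pose F : {linear C -> k^o} := HB.pack f fl.
exact: (lfunE F c).
Qed.

Definition dual_one : dual C := dual_of (fun c => counit c).
Definition dual_mul a b : dual C :=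
  dual_of (conv (A := k^o) (dual_ev a) (dual_ev b)).

Lemma dual_one_subE c : dual_one c = counit c.
Proof. by rewrite dual_ofE //; lin_tac. Qed.

Lemma dual_mul_subE a b c : dual_mul a b c = conv (A := k^o) a b c.
Proof. by rewrite dual_ofE //; apply: conv_lin; lin_tac. Qed.

Lemma conv_unitE c : conv_unit k^o c = counit c.
Proof. exact: mulr1. Qed.

Fact dual_mulA : associative dual_mul.
Proof.
move=> a b d; apply: dualP => c; rewrite !dual_mul_subE.
rewrite (@eq_conv _ C k^o a a _ _ (frefl _) (dual_mul_subE b d)).
rewrite (@eq_conv _ C k^o _ _ d d (dual_mul_subE a b) (frefl _)).
by apply: (@convA _ _ k^o); lin_tac.
Qed.

Fact dual_mul1l : left_id dual_one dual_mul.
Proof.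
move=> a; apply: dualP => c; rewrite dual_mul_subE.
rewrite -[RHS](@conv1l _ _ k^o); last by lin_tac.
by apply: (@eq_conv _ C k^o _ _ a a) => // x; rewrite dual_one_subE conv_unitE.
Qed.

Fact dual_mul1r : right_id dual_one dual_mul.
Proof.
move=> a; apply: dualP => c; rewrite dual_mul_subE.
rewrite -[RHS](@conv1r _ _ k^o); last by lin_tac.
by apply: (@eq_conv _ C k^o a a) => // x; rewrite dual_one_subE conv_unitE.
Qed.

Fact dual_mulDl : left_distributive dual_mul +%R.
Proof.
move=> a b d; apply: dualP => c; rewrite dualD !dual_mul_subE /conv.
rewrite -big_split; apply: eq_bigr => i _; rewrite dualD.
exact: mulrDl.
Qed.

Fact dual_mulDr : right_distributive dual_mul +%R.
Proof.
move=> a b d; apply: dualP => c; rewrite dualD !dual_mul_subE /conv.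
rewrite -big_split; apply: eq_bigr => i _; rewrite dualD.
exact: mulrDr.
Qed.

Fact dual_one_neq0 : dual_one != 0.
Proof.
have [c nc] := @counit_neq0 _ C; apply: contraNneq nc => one0.
by rewrite -dual_one_subE one0 dual0E.
Qed.

HB.instance Definition _ := GRing.Zmodule_isNzRing.Build (dual C)
  dual_mulA dual_mul1l dual_mul1r dual_mulDl dual_mulDr dual_one_neq0.

Fact dual_scaleAl x a b : x *: (a * b) = x *: a * b.
Proof.
apply: dualP => c; rewrite dualZ !dual_mul_subE /conv [RHS]/tsum mulr_sumr.
by apply: eq_bigr => i _; rewrite dualZ; apply: mulrA.
Qed.
HB.instance Definition _ :=
  GRing.Lmodule_isLalgebra.Build k (dual C) dual_scaleAl.

Fact dual_scaleAr x a b : x *: (a * b) = a * (x *: b).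
Proof.
apply: dualP => c; rewrite dualZ !dual_mul_subE /conv [RHS]/tsum mulr_sumr.
by apply: eq_bigr => i _; rewrite dualZ; apply: mulrCA.
Qed.
HB.instance Definition _ :=
  GRing.Lalgebra_isAlgebra.Build k (dual C) dual_scaleAr.

HB.instance Definition _ := Algebra_isFalgebra.Build k (dual C).

Lemma dual1E c : (1 : dual C) c = counit c.
Proof. exact: dual_one_subE. Qed.

Lemma dualME a b c :
  (a * b) c = \T_(c1, c2 <- coprod c) (a c1 * b c2 : k^o).
Proof. exact: dual_mul_subE. Qed.

End DualAlgebra.

Ltac lin_hook ::= apply: dual_ev_lin; lin_tac.

HB.mixin Record isHopf (k : fieldType) H
    of isNzCoalgebra k H & Falgebra k H := {
  coprodM : forall h g : H, coprod (h * g) =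
    \T_(h1, h2 <- coprod h) \T_(g1, g2 <- coprod g) (h1 * g1) ⊗ (h2 * g2);
  coprod1 : coprod (1 : H) = 1 ⊗ 1;
  counitM : forall h g : H, counit (h * g) = counit h * counit g;
  counit1 : counit (1 : H) = 1;
  antipode : {linear H -> H};
  antipodel : forall h : H,
    \T_(h1, h2 <- coprod h) (antipode h1 * h2) = counit h *: 1;
  antipoder : forall h : H,
    \T_(h1, h2 <- coprod h) (h1 * antipode h2) = counit h *: 1 }.

(* Finite-dimensional Hopf algebras; the antipode is not assumed bijective.    *)
#[short(type="hopfAlgType")]
HB.structure Definition Hopf (k : fieldType) :=
  { H of isHopf k H & NzCoalgebra k H & Falgebra k H }.

Section HopfTheory.
Variables (k : fieldType) (H : hopfAlgType k).
Implicit Types h g : H.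

Lemma coprodM_fun (W : lmodType k) (F : H -> H -> W) h g :
  (forall y, lin (F^~ y)) -> (forall x, lin (F x)) ->
  tsum (coprod (h * g)) F = \T_(h1, h2 <- coprod h) \T_(g1, g2 <- coprod g)
                              F (h1 * g1) (h2 * g2).
Proof.
move=> hl hr; rewrite coprodM (lin_tsumE _ _ (f := fun s => tsum s _)); last by lin_tac.
apply: eq_tsum => c1 c2.
rewrite (lin_tsumE _ _ (f := fun s => tsum s _)); last by lin_tac.
by apply: eq_tsum => d1 d2; rewrite tsum_tens // => ?; lin_tac.
Qed.

Lemma antipode1 : antipode (1 : H) = 1.
Proof.
have := antipodel (1 : H); rewrite coprod1 counit1 scale1r tsum_tens.
- by rewrite mulr1.
- by move=> ?; lin_tac.
- by move=> ?; lin_tac.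
Qed.

Lemma antipodeM h g : antipode (h * g) = antipode g * antipode h.
Proof.
pose mu (t : (H ⊗ H)%type) := \T_(x, y <- t) (x * y).
pose F (t : (H ⊗ H)%type) := \T_(x, y <- t) antipode (x * y).
pose G (t : (H ⊗ H)%type) := \T_(x, y <- t) (antipode y * antipode x).
have hmu : lin mu by rewrite /mu; lin_tac.
have hF : lin F by rewrite /F; lin_tac.
have hG : lin G by rewrite /G; lin_tac.
have muE x y : mu (x ⊗ y) = x * y.
  by rewrite /mu tsum_tens // => ?; lin_tac.
have FE x y : F (x ⊗ y) = antipode (x * y).
  by rewrite /F tsum_tens // => ?; lin_tac.
have GE x y : G (x ⊗ y) = antipode y * antipode x.
  by rewrite /G tsum_tens // => ?; lin_tac.
rewrite -FE -GE; apply: (conv_inv_uniq hmu hF hG).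
- apply: tensor_lin_ext => [||{h g} h g]; [exact: conv_lin|exact: conv_unit_lin|].
  rewrite conv_tensE //; transitivity (counit (h * g) *: (1 : H)); last first.
    by rewrite /conv_unit [counit (_ ⊗ _)]tensor_counitE counitM.
  rewrite -antipodel coprodM_fun; try by move=> ?; lin_tac.
  by apply: eq_tsum => h1 h2; apply: eq_tsum => g1 g2; rewrite FE muE.
- apply: tensor_lin_ext => [||{h g} h g]; [exact: conv_lin|exact: conv_unit_lin|].
  rewrite conv_tensE // /conv_unit [counit (_ ⊗ _)]tensor_counitE.
  transitivity (\T_(h1, h2 <- coprod h) (h1 * (counit g *: 1) * antipode h2)).
    apply: eq_tsum => h1 h2; rewrite -(antipoder g).
    rewrite (lin_tsumE _ _ (f := fun s => _ * s * _)); last by lin_tac.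
    by apply: eq_tsum => g1 g2; rewrite GE muE !mulrA.
  rewrite mulrC -scalerA -(antipoder h).
  rewrite [in RHS](lin_tsumE _ _ (f := fun s => _ *: s)); last by lin_tac.
  by apply: eq_tsum => h1 h2; rewrite -scalerAr mulr1 scalerAl.
Qed.

End HopfTheory.

Section DualTensor.
Variables (k : fieldType) (C D : nzCoalgType k).

Definition dual_tensor (f : C -> D -> k) : (dual C ⊗ dual D)%type :=
  Tensor [ffun i => dual_of (fun c => tcoord i (dual_of (f c)))].

(* f(c, d) = <f^1, c><f^2, d>                                                  *)
Lemma dual_tensorE (f : C -> D -> k) c d :
  (forall y, lin (V := k^o) (f^~ y)) -> (forall x, lin (V := k^o) (f x)) ->
  \T_(a, b <- dual_tensor f) (a c * b d : k^o) = f c d.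
Proof.
move=> hl hr; rewrite -[RHS]dual_ofE // [dual_of (f c)]tbase_sum. rewrite dual_sumE.
apply: eq_bigr => i _; rewrite dualZ ffunE dual_ofE // => a x y.
transitivity (tcoord i (a *: dual_of (f x) + dual_of (f y))); last exact: tcoord_lin.
apply: (congr1 (tcoord i)); apply: dualP => z.
by rewrite dualD dualZ !dual_ofE // hl.
Qed.

Definition dual_contr (U : lmodType k) (d : D) (t : (U ⊗ dual D)%type) : U :=
  \T_(u, b <- t) (b d *: u).

Lemma dual_contr_lin (U : lmodType k) d : lin (@dual_contr U d).
Proof. by rewrite /dual_contr; lin_tac. Qed.

Lemma dual_contr_tens (U : lmodType k) d (u : U) b :
  dual_contr d (u ⊗ b) = b d *: u.
Proof.
by rewrite /dual_contr tsum_tens // => ?; lin_tac.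
Qed.

Lemma dual_contr_ext (U : lmodType k) (t s : (U ⊗ dual D)%type) :
  (forall d, dual_contr d t = dual_contr d s) -> t = s.
Proof.
move=> ts; apply: val_inj; apply/ffunP => j /=.
pose f i : dual D := dual_of (fun d => tcoord i d).
have fE i d : f i d = tcoord i d.
  by rewrite dual_ofE // => a x y; rewrite /tcoord linearP.
have bE (b : dual D) : b = \sum_i b (tbase i) *: f i.
  apply: dualP => d; rewrite dual_sumE [in LHS](tbase_sum d) linear_sum.
  by apply: eq_bigr => i _; rewrite dualZ fE linearZ mulrC.
pose d := \sum_i tcoord j (f i) *: @tbase k D i.
have dE (b : dual D) : b d = tcoord j b.
  rewrite /d [in RHS](bE b) /tcoord linear_sum linear_sum; apply: eq_bigr => i _.
  by rewrite !linearZ; apply: mulrC.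
have := ts d; rewrite /dual_contr /tsum.
rewrite (bigD1 j) //= big1 => [|i ij]; last first.
  by rewrite dE tcoord_tbase (negPf ij) scale0r.
rewrite [in RHS](bigD1 j) //= big1 => [|i ij]; last first.
  by rewrite dE tcoord_tbase (negPf ij) scale0r.
by rewrite !addr0 dE tcoord_tbase eqxx !scale1r.
Qed.

End DualTensor.
Section DualTsum.
Variables (k : fieldType) (C : nzCoalgType k) (U : lmodType k) (V : vectType k).

Lemma dual_tsumE (t : (U ⊗ V)%type) (F : U -> V -> dual C) c :
  tsum t F c = \T_(x, y <- t) (F x y c : k^o).
Proof. exact: dual_sumE. Qed.

Lemma dual_tsum_arg (t : (U ⊗ V)%type) (F : U -> V -> C) (a : dual C) :
  a (tsum t F) = \T_(x, y <- t) (a (F x y) : k^o).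
Proof. by rewrite (lin_tsumE _ _ (lin_scalar a)). Qed.

Lemma eq_tsumk (t : (U ⊗ V)%type) (F G : U -> V -> k) :
  (forall x y, F x y = G x y) ->
  \T_(x, y <- t) (F x y : k^o) = \T_(x, y <- t) (G x y : k^o) :> k.
Proof. exact: (@eq_tsum _ _ _ k^o). Qed.

Lemma tsum_exchangek (X : lmodType k) (Y : vectType k)
    (F : U -> V -> X -> Y -> k) (t : (U ⊗ V)%type) (s : (X ⊗ Y)%type) :
  \T_(x, y <- t) \T_(z, w <- s) (F x y z w : k^o)
    = \T_(z, w <- s) \T_(x, y <- t) (F x y z w : k^o) :> k.
Proof. exact: exchange_big. Qed.

Lemma tsum_mull (t : (U ⊗ V)%type) (F : U -> V -> k) (c : k) :
  (\T_(x, y <- t) (F x y : k^o)) * c = \T_(x, y <- t) (F x y * c : k^o).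
Proof. exact: mulr_suml. Qed.

Lemma tsum_mulr (t : (U ⊗ V)%type) (F : U -> V -> k) (c : k) :
  c * (\T_(x, y <- t) (F x y : k^o)) = \T_(x, y <- t) (c * F x y : k^o).
Proof. exact: mulr_sumr. Qed.

End DualTsum.

Section DualHopf.
Variables (k : fieldType) (H : hopfAlgType k).
Implicit Types (a b : dual H) (h g : H).

(* <a_(1), h><a_(2), g> = <a, h g>                                             *)
Definition dual_coprod a : (dual H ⊗ dual H)%type :=
  dual_tensor (fun h g => a (h * g)).
Definition dual_counit a : k := a 1.
Definition dual_antipode a : dual H := dual_of (fun h => a (antipode h)).

Lemma dual_coprodE a h g :
  \T_(a1, a2 <- dual_coprod a) (a1 h * a2 g : k^o) = a (h * g).
Proof.
apply: (dual_tensorE (f := fun h g => a (h * g))) => x.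
  by apply: (lin_comp (lin_scalar a)); lin_tac.
by apply: (lin_comp (lin_scalar a)); lin_tac.
Qed.

Lemma dual_antipodeE a h : dual_antipode a h = a (antipode h).
Proof. by rewrite dual_ofE //; apply: (lin_comp (lin_scalar a)); lin_tac. Qed.

Lemma dual_contrE (t : (dual H ⊗ dual H)%type) h g :
  dual_contr g t h = \T_(a1, a2 <- t) (a1 h * a2 g : k^o).
Proof. by rewrite dual_tsumE; apply: eq_tsumk => a b; rewrite dualZ mulrC. Qed.

Lemma dual_coprod_contr a h g : dual_contr g (dual_coprod a) h = a (h * g).
Proof. by rewrite dual_contrE dual_coprodE. Qed.

Fact dual_coprod_lin : linear dual_coprod.
Proof.
move=> x a b; apply: dual_contr_ext => g; apply: dualP => h.
rewrite (dual_contr_lin g) dualD dualZ !dual_coprod_contr.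
by rewrite dualD dualZ.
Qed.
HB.instance Definition _ :=
  GRing.isLinear.Build k _ _ _ dual_coprod dual_coprod_lin.

Fact dual_counit_scalar : scalar dual_counit.
Proof. by move=> x a b; rewrite /dual_counit dualD dualZ. Qed.
HB.instance Definition _ :=
  GRing.isLinear.Build k _ k *%R dual_counit dual_counit_scalar.

Fact dual_antipode_lin : linear dual_antipode.
Proof.
by move=> x a b; apply: dualP => h; rewrite dualD dualZ !dual_antipodeE dualD dualZ.
Qed.
HB.instance Definition _ :=
  GRing.isLinear.Build k _ _ _ dual_antipode dual_antipode_lin.

Fact dual_counitl a :
  \T_(x, y <- dual_coprod a) (dual_counit x *: y) = a.
Proof.
apply: dualP => g; rewrite dual_tsumE.
under eq_tsum do rewrite dualZ.
by rewrite dual_coprodE mul1r.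
Qed.

Fact dual_counitr a :
  \T_(x, y <- dual_coprod a) (dual_counit y *: x) = a.
Proof.
apply: dualP => g; rewrite dual_tsumE.
under eq_tsum do rewrite dualZ mulrC.
by rewrite dual_coprodE mulr1.
Qed.

Fact dual_counit_neq0 : exists a, dual_counit a != 0.
Proof. by exists 1; rewrite /dual_counit dual1E counit1 oner_neq0. Qed.

Fact dual_coprodA a :
  \T_(x, y <- dual_coprod a) \T_(x1, x2 <- dual_coprod x) (x1 ⊗ x2) ⊗ y
    = \T_(x, y <- dual_coprod a) \T_(y1, y2 <- dual_coprod y) (x ⊗ y1) ⊗ y2.
Proof.
apply: dual_contr_ext => g3; rewrite !(lin_tsumE _ _ (dual_contr_lin g3)).
transitivity (dual_coprod (dual_contr g3 (dual_coprod a))).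
  rewrite [in RHS](lin_tsumE _ _ (linE dual_coprod)); apply: eq_tsum => x y.
  rewrite (lin_tsumE _ _ (dual_contr_lin g3)) linearZ /=.
  rewrite -[in RHS](tsum_eta (dual_coprod x)) [in RHS](lin_tsumE _ _ (f := fun s => y g3 *: s)).
    by apply: eq_tsum => *; rewrite dual_contr_tens.
  by lin_tac.
apply: dual_contr_ext => g2; apply: dualP => g1; rewrite !dual_coprod_contr.
rewrite (lin_tsumE _ _ (dual_contr_lin g2)) dual_tsumE -mulrA -dual_coprodE.
apply: eq_tsumk => x y; rewrite (lin_tsumE _ _ (dual_contr_lin g3)).
rewrite (lin_tsumE _ _ (dual_contr_lin g2)) dual_tsumE.
rewrite -dual_coprodE tsum_mulr; apply: eq_tsumk => y1 y2.
rewrite dual_contr_tens (linZ (dual_contr_lin _)) dual_contr_tens !dualZ.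
by rewrite mulrC [y1 _ * _]mulrC mulrA.
Qed.

HB.instance Definition _ := isNzCoalgebra.Build k (dual H)
  dual_coprodA dual_counitl dual_counitr dual_counit_neq0.

Fact dual_coprodM a b : dual_coprod (a * b) =
  \T_(a1, a2 <- dual_coprod a) \T_(b1, b2 <- dual_coprod b)
    (a1 * b1) ⊗ (a2 * b2).
Proof.
apply: dual_contr_ext => g; apply: dualP => h; rewrite dual_coprod_contr dualME.
rewrite (coprodM_fun (W := k^o)); [|by move=> ?; lin_tac|by move=> ?; lin_tac].
rewrite (lin_tsumE _ _ (dual_contr_lin _)) dual_tsumE.
transitivity (\T_(a1, a2 <- dual_coprod a) \T_(b1, b2 <- dual_coprod b)
  \T_(h1, h2 <- coprod h) \T_(g1, g2 <- coprod g)
    ((a1 h1 * b1 h2) * (a2 g1 * b2 g2) : k^o) : k).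
  under [RHS]eq_tsum => a1 a2 do rewrite tsum_exchange.
  rewrite [RHS]tsum_exchange; apply: eq_tsumk => h1 h2.
  under [RHS]eq_tsum => a1 a2 do rewrite tsum_exchange.
  rewrite [RHS]tsum_exchange; apply: eq_tsumk => g1 g2.
  rewrite -!dual_coprodE tsum_mull; apply: eq_tsumk => a1 a2.
  by rewrite tsum_mulr; apply: eq_tsumk => b1 b2; rewrite mulrACA.
apply: eq_tsumk => a1 a2; rewrite (lin_tsumE _ _ (dual_contr_lin _)) dual_tsumE.
apply: eq_tsumk => b1 b2; rewrite dual_contr_tens dualZ !dualME mulrC tsum_mull.
by apply: eq_tsumk => h1 h2; rewrite tsum_mulr.
Qed.

Fact dual_coprod1 : dual_coprod 1 = 1 ⊗ 1.
Proof.
apply: dual_contr_ext => g; apply: dualP => h; rewrite dual_coprod_contr.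
by rewrite dual_contr_tens dualZ !dual1E counitM mulrC.
Qed.

Fact dual_counitM a b : dual_counit (a * b) = dual_counit a * dual_counit b.
Proof.
rewrite /dual_counit dualME coprod1 (tsum_tens (W := k^o)) // => ?.
  by apply: lin_kmull; lin_tac.
by apply: lin_kmulr; lin_tac.
Qed.

Fact dual_counit1 : dual_counit 1 = 1.
Proof. by rewrite /dual_counit dual1E counit1. Qed.

Fact dual_antipodel a :
  \T_(a1, a2 <- dual_coprod a) (dual_antipode a1 * a2) = dual_counit a *: 1.
Proof.
apply: dualP => h; rewrite dual_tsumE dualZ dual1E.
transitivity (\T_(h1, h2 <- coprod h) (a (antipode h1 * h2) : k^o) : k).
  under [RHS]eq_tsum => h1 h2 do rewrite -dual_coprodE.
  rewrite [RHS]tsum_exchange; apply: eq_tsumk => a1 a2; rewrite dualME.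
  by apply: eq_tsumk => h1 h2; rewrite dual_antipodeE.
by rewrite -dual_tsum_arg antipodel linearZ mulrC.
Qed.

Fact dual_antipoder a :
  \T_(a1, a2 <- dual_coprod a) (a1 * dual_antipode a2) = dual_counit a *: 1.
Proof.
apply: dualP => h; rewrite dual_tsumE dualZ dual1E.
transitivity (\T_(h1, h2 <- coprod h) (a (h1 * antipode h2) : k^o) : k).
  under [RHS]eq_tsum => h1 h2 do rewrite -dual_coprodE.
  rewrite [RHS]tsum_exchange; apply: eq_tsumk => a1 a2; rewrite dualME.
  by apply: eq_tsumk => h1 h2; rewrite dual_antipodeE.
by rewrite -dual_tsum_arg antipoder linearZ mulrC.
Qed.

HB.instance Definition _ := isHopf.Build k (dual H)
  dual_coprodM dual_coprod1 dual_counitM dual_counit1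
  dual_antipodel dual_antipoder.

End DualHopf.
Record drinfeld_yetter (k : fieldType) (H : hopfAlgType k) (B : lmodType k)
    (act : B -> H -> B) (coact : B -> (B ⊗ H)%type) : Prop := {
  act_linl : forall h, linear (act^~ h);
  act_linr : forall b, linear (act b);
  act1 : forall b, act b 1 = b;
  actM : forall b h g, act b (h * g) = act (act b h) g;
  coact_lin : linear coact;
  coactA : forall b,
    \T_(x, h <- coact b) \T_(y, g <- coact x) (y ⊗ g) ⊗ h
      = \T_(x, h <- coact b) \T_(h1, h2 <- coprod h) (x ⊗ h1) ⊗ h2;
  coact_counit : forall b, \T_(x, h <- coact b) (counit h *: x) = b;
  act_coact : forall b h,
    \Sw[2]_(h1 h2 <- h) \T_(x, y <- coact (act b h2)) x ⊗ (h1 * y)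
      = \Sw[2]_(h1 h2 <- h) \T_(x, y <- coact b) act x h1 ⊗ (y * h2) }.

Record braided_commutative (k : fieldType) (H : hopfAlgType k) (B : algType k)
    (act : B -> H -> B) (coact : B -> (B ⊗ H)%type) : Prop := {
  bc_drinfeld_yetter : drinfeld_yetter act coact;
  act_mul : forall a b h,
    act (a * b) h = \Sw[2]_(h1 h2 <- h) (act a h1 * act b h2);
  act_one : forall h, act 1 h = counit h *: 1;
  coact_mul : forall a b, coact (a * b) =
    \T_(x, h <- coact a) \T_(y, g <- coact b) (x * y) ⊗ (h * g);
  coact_one : coact 1 = 1 ⊗ 1;
  bc_comm : forall a b, a * b = \T_(x, h <- coact b) (x * act a h) }.

(* Braided-commutative algebras in the category of right Drinfeld-Yetter       *)
(* modules over H.                                                             *)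
Record bcAlgType (k : fieldType) (H : hopfAlgType k) := BcAlgType {
  bc_sort :> algType k;
  bc_act : bc_sort -> H -> bc_sort;
  bc_coact : bc_sort -> (bc_sort ⊗ H)%type;
  bc_axioms : braided_commutative bc_act bc_coact }.

Notation "b ◁ h" := (bc_act b h) (at level 39, left associativity) : ring_scope.

(* Maps on H (x) H are linear maps on the tensor product, evaluated at h (x) g. *)
Record Z2 (k : fieldType) (H : hopfAlgType k) (B : bcAlgType H)
    (gamma : {linear (H ⊗ H)%type -> B}) : Prop := {
  Z2_invertible : conv_invertible gamma;
  Z2_unitr : forall h : H, gamma (h ⊗ 1) = counit h *: 1;
  Z2_unitl : forall h : H, gamma (1 ⊗ h) = counit h *: 1;
  Z2_cocycle : forall f g h : H,
    \Sw[2]_(f1 f2 <- f) \Sw[2]_(g1 g2 <- g) \Sw[2]_(h1 h2 <- h)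
      ((gamma (g1 ⊗ f1) ◁ h1) * gamma (h2 ⊗ (f2 * g2)))
    = \Sw[2]_(g1 g2 <- g) \Sw[2]_(h1 h2 <- h)
      (gamma (h1 ⊗ g1) * gamma ((g2 * h2) ⊗ f));
  Z2_act : forall (g h : H) (b : B),
    \Sw[2]_(g1 g2 <- g) \Sw[2]_(h1 h2 <- h)
      (gamma (h1 ⊗ g1) * (b ◁ (g2 * h2)))
    = \Sw[2]_(g1 g2 <- g) \Sw[2]_(h1 h2 <- h)
      ((b ◁ (g1 * h1)) * gamma (h2 ⊗ g2));
  Z2_act_coact : forall (g h : H) (b : B),
    \Sw[2]_(h1 h2 <- h) (gamma (h1 ⊗ g) * (b ◁ h2))
    = \Sw[2]_(h1 h2 <- h) \T_(b0, b1 <- bc_coact b)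
      ((b0 ◁ h1) * gamma (h2 ⊗ (g * b1)));
  Z2_coact : forall (g h : H) (b : B),
    \T_(b0, b1 <- bc_coact b) (b0 * gamma ((h * b1) ⊗ g))
    = gamma (h ⊗ g) * b }.

Section DualBraidedCommutative.
Variables (k : fieldType) (H : hopfAlgType k).
Implicit Types (a b c : dual H) (h g x : H).

Definition dual_act a h : dual H := \T_(a1, a2 <- coprod a) (a1 h *: a2).

Definition dual_ad b a : dual H :=
  \T_(b1, b2 <- coprod b) (b1 * a * antipode b2).

(* (id (x) b)(dual_coact a) = b_(1) a S(b_(2)); see dual_coactE.               *)
Definition dual_coact a : (dual H ⊗ H)%type :=
  Tensor [ffun i => dual_ad (dual_of (fun h => tcoord i h)) a].

Definition contr (U : lmodType k) b (t : (U ⊗ H)%type) : U :=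
  \T_(u, h <- t) (b h *: u).

Lemma contr_lin (U : lmodType k) b : lin (@contr U b).
Proof. by rewrite /contr; lin_tac. Qed.

Lemma contr_tens (U : lmodType k) b (u : U) h : contr b (u ⊗ h) = b h *: u.
Proof. by rewrite /contr tsum_tens // => ?; lin_tac. Qed.

Lemma contr_ext (U : lmodType k) (t s : (U ⊗ H)%type) :
  (forall b, contr b t = contr b s) -> t = s.
Proof.
move=> ts; apply: val_inj; apply/ffunP => j /=.
have := ts (dual_of (fun h => tcoord j h)); rewrite /contr /tsum.
have E i : dual_of (fun h => tcoord j h) (tbase i) = (i == j)%:R.
  by rewrite dual_ofE ?tcoord_tbase //; lin_tac.
rewrite (bigD1 j) //= big1 => [|i ij]; last by rewrite E (negPf ij) scale0r.
rewrite [in RHS](bigD1 j) //= big1 => [|i ij]; last by rewrite E (negPf ij) scale0r.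
by rewrite !addr0 E eqxx !scale1r.
Qed.

Lemma dual_ad_linl a : lin (dual_ad^~ a).
Proof. by rewrite /dual_ad; lin_tac. Qed.

Lemma dual_ad_linr b : lin (dual_ad b).
Proof. by rewrite /dual_ad; lin_tac. Qed.

Lemma dual_actE a h x : dual_act a h x = a (h * x).
Proof.
rewrite dual_tsumE -dual_coprodE; apply: eq_tsumk => a1 a2; exact: dualZ.
Qed.

Lemma dual_coactE a b : contr b (dual_coact a) = dual_ad b a.
Proof.
have -> : b = \sum_i b (tbase i) *: dual_of (fun h => tcoord i h).
  apply: dualP => h; rewrite dual_sumE [in LHS](tbase_sum h) linear_sum.
  by apply: eq_bigr => i _; rewrite dualZ dual_ofE ?linearZ 1?mulrC //; lin_tac.
rewrite (lin_sum (dual_ad_linl a)).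
apply: eq_bigr => i _; rewrite (linZ (dual_ad_linl a)) ffunE.
congr (_ *: _); rewrite dual_sumE (bigD1 i) //= big1 => [|j ji].
  by rewrite addr0 dualZ dual_ofE ?tcoord_tbase ?eqxx ?mulr1 //; lin_tac.
rewrite dualZ dual_ofE ?tcoord_tbase; last by lin_tac.
by rewrite eq_sym (negPf ji) mulr0.
Qed.

Lemma dual_adE a b x : dual_ad b a x =
  \T_(x1, x' <- coprod x) \T_(x2, x3 <- coprod x')
    (b (x1 * antipode x3) * a x2 : k^o).
Proof.
rewrite dual_tsumE.
transitivity (\T_(b1, b2 <- coprod b) \T_(x1, x' <- coprod x)
  \T_(x2, x3 <- coprod x') ((b1 x1 * b2 (antipode x3)) * a x2 : k^o) : k).
  apply: eq_tsumk => b1 b2; rewrite -mulrA dualME; apply: eq_tsumk => x1 x'.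
  rewrite dualME tsum_mulr; apply: eq_tsumk => x2 x3.
  by rewrite dual_antipodeE mulrA mulrAC.
rewrite tsum_exchangek; apply: eq_tsumk => x1 x'.
rewrite tsum_exchangek; apply: eq_tsumk => x2 x3.
by rewrite -tsum_mull dual_coprodE.
Qed.

Lemma dual_ad1 a : dual_ad 1 a = a.
Proof.
rewrite /dual_ad coprod1 tsum_tens.
- by rewrite antipode1 mul1r mulr1.
- by move=> ?; lin_tac.
- by move=> ?; lin_tac.
Qed.

Lemma dual_adM b c a : dual_ad (b * c) a = dual_ad b (dual_ad c a).
Proof.
rewrite /dual_ad coprodM_fun; try by move=> ?; lin_tac.
apply: eq_tsum => b1 b2; rewrite (lin_tsumE _ _ (f := fun s => _ * s * _));
  last by lin_tac.
by apply: eq_tsum => c1 c2; rewrite antipodeM !mulrA.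
Qed.

Lemma dual_ad_mul c a b :
  \T_(c1, c2 <- coprod c) (dual_ad c1 a * dual_ad c2 b) = dual_ad c (a * b).
Proof.
transitivity (\T_(p, z <- coprod c) \T_(q, w <- coprod z) \T_(r, s <- coprod w)
  (p * a * antipode q * (r * b * antipode s))).
  rewrite -(coprodA_fun c (F := fun p q z => \T_(r, s <- coprod z)
    (p * a * antipode q * (r * b * antipode s)))); try by move=> *; lin_tac.
  apply: eq_tsum => c1 c2; rewrite (lin_tsumE _ _ (f := fun s => s * _));
    last by lin_tac.
  apply: eq_tsum => p q; rewrite (lin_tsumE _ _ (f := fun s => _ * s)) //.
  by lin_tac.
apply: eq_tsum => p z.
rewrite -(coprodA_fun z (F := fun q r s =>
  p * a * antipode q * (r * b * antipode s))); try by move=> *; lin_tac.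
rewrite -[z in RHS]counitl.
rewrite [RHS](lin_tsumE _ _ (f := fun s => p * (a * b) * antipode s)); last by lin_tac.
apply: eq_tsum => t s.
transitivity (p * a * (\T_(q, r <- coprod t) (antipode q * r)) *
  (b * antipode s)).
  rewrite (lin_tsumE _ _ (f := fun u => _ * u * _)); last by lin_tac.
  by apply: eq_tsum => *; rewrite !mulrA.
by rewrite antipodel linearZ /= -!scalerAr mulr1 -scalerAl !mulrA.
Qed.

Fact dual_drinfeld_yetter : drinfeld_yetter dual_act dual_coact.
Proof.
split.
- by move=> h x a b; apply: dualP => y; rewrite dualD dualZ !dual_actE dualD dualZ.
- move=> a x h g; apply: dualP => y.
  by rewrite dualD dualZ !dual_actE mulrDl -scalerAl linearP.
- by move=> a; apply: dualP => y; rewrite dual_actE mul1r.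
- by move=> a h g; apply: dualP => y; rewrite !dual_actE mulrA.
- move=> x a b; apply: contr_ext => c.
  by rewrite (contr_lin c) !dual_coactE (dual_ad_linr c).
- move=> a; apply: contr_ext => c; rewrite !(lin_tsumE _ _ (contr_lin c)).
  transitivity (\T_(y, h <- dual_coact a) (c h *: dual_coact y)).
    apply: eq_tsum => y h; rewrite (lin_tsumE _ _ (contr_lin c)).
    rewrite -[in RHS](tsum_eta (dual_coact y)).
    rewrite [in RHS](lin_tsumE _ _ (f := fun s => c h *: s)); last by lin_tac.
    by apply: eq_tsum => *; rewrite contr_tens.
  apply: contr_ext => b; rewrite !(lin_tsumE _ _ (contr_lin b)).
  transitivity (dual_ad (b * c) a).
    rewrite dual_adM -[dual_ad c a]dual_coactE.
    rewrite [in RHS](lin_tsumE _ _ (dual_ad_linr b)).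
    apply: eq_tsum => y h.
    by rewrite (linZ (contr_lin b)) dual_coactE (linZ (dual_ad_linr b)).
  rewrite -dual_coactE; apply: eq_tsum => y h.
  rewrite (lin_tsumE _ _ (contr_lin c)) (lin_tsumE _ _ (contr_lin b)).
  rewrite dualME (lin_tsumE _ _ (f := fun s : k^o => s *: y)); last by lin_tac.
  apply: eq_tsum => h1 h2.
  by rewrite contr_tens (linZ (contr_lin b)) contr_tens scalerA mulrC.
- move=> a; rewrite -[RHS]dual_ad1 -dual_coactE.
  by apply: eq_tsum => y h; rewrite dual1E.
- move=> b h; apply: contr_ext => c; rewrite /=.
  rewrite !(lin_tsumE _ _ (contr_lin c)); apply: dualP => z; rewrite !dual_tsumE.
  transitivity (\T_(h1, h2 <- coprod h) \T_(z1, z' <- coprod z)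
    \T_(z2, z3 <- coprod z')
    (c (h1 * z1 * antipode z3) * b (h2 * z2) : k^o) : k).
    apply: eq_tsumk => h1 h2.
    transitivity (dual_ad (dual_act c h1) (dual_act b h2) z).
      rewrite -dual_coactE (lin_tsumE _ _ (contr_lin c)).
      congr (dual_ev _ _); apply: eq_tsum => x y.
      by rewrite contr_tens dual_actE.
    rewrite dual_adE; apply: eq_tsumk => z1 z'; apply: eq_tsumk => z2 z3.
    by rewrite !dual_actE mulrA.
  pose L p r : k := \T_(z1, z' <- coprod z) \T_(z2, z3 <- coprod z')
    (c (p * z1 * antipode z3) * b (r * z2) : k^o).
  pose G p r s v : k := \T_(z1, z' <- coprod z) \T_(z2, z3 <- coprod z')
    (c (p * z1 * antipode (s * z3) * v) * b (r * z2) : k^o).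
  have L2 p : lin (V := k^o) (L p) by rewrite /L; lin_tac.
  have G1 r s v : lin (V := k^o) (fun p => G p r s v) by rewrite /G; lin_tac.
  have G2 p s v : lin (V := k^o) (fun r => G p r s v) by rewrite /G; lin_tac.
  have G3 p r v : lin (V := k^o) (fun s => G p r s v) by rewrite /G; lin_tac.
  have G4 p r s : lin (V := k^o) (fun v => G p r s v) by rewrite /G; lin_tac.
  transitivity (\T_(u, v <- coprod h) \T_(p, q <- coprod u)
    \T_(r, s <- coprod q) (G p r s v : k^o) : k); last first.
    apply: eq_tsumk => u v.
    pose c' : dual H := dual_of (fun y => c (y * v)).
    have c'E y : c' y = c (y * v) by rewrite dual_ofE //; lin_tac.
    transitivity (dual_act (dual_ad c' b) u z); last first.
      rewrite -dual_coactE (lin_tsumE _ _ (contr_lin c)); congr (dual_ev _ _).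
      have hA : lin (dual_act^~ u) by rewrite /dual_act; lin_tac.
      rewrite [LHS](lin_tsumE _ _ hA); apply: eq_tsum => x y.
      by rewrite contr_tens (linZ hA) c'E.
    rewrite dual_actE dual_adE.
    rewrite (coprodM_fun (W := k^o)); [|by move=> ?; lin_tac|by move=> ?; lin_tac].
    apply: eq_tsumk => p q.
    rewrite tsum_exchangek; apply: eq_tsumk => z1 z'.
    rewrite (coprodM_fun (W := k^o)); [|by move=> ?; lin_tac|by move=> ?; lin_tac].
    apply: eq_tsumk => r s; apply: eq_tsumk => z2 z3.
    by rewrite c'E.
  rewrite [RHS](coprodA_fun (W := k^o) h (F := fun p q v =>
    \T_(r, s <- coprod q) (G p r s v : k^o))); try by move=> *; lin_tac.
  apply: eq_tsumk => p m.
  rewrite [RHS](coprodA_fun (W := k^o) m (F := fun r s v => G p r s v)) //.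
  rewrite -[m in LHS]counitr -[LHS]/(L p _) (lin_tsumE _ _ (L2 p)).
  apply: eq_tsumk => r n; rewrite (linZ (L2 p)) /L.
  transitivity (\T_(z1, z' <- coprod z) \T_(z2, z3 <- coprod z')
    \T_(s, v <- coprod n)
      (c (p * z1 * antipode z3 * (antipode s * v)) * b (r * z2) : k^o) : k).
    rewrite [LHS]tsum_mulr; apply: eq_tsumk => z1 z'.
    rewrite tsum_mulr; apply: eq_tsumk => z2 z3.
    rewrite -tsum_mull mulrA; congr (_ * _).
    rewrite -(dual_tsum_arg _ (fun s v => p * z1 * antipode z3 * (antipode s * v))).
    rewrite -(lin_tsumE (fun s v => antipode s * v) _
      (f := fun s => p * z1 * antipode z3 * s)); last by lin_tac.
    by rewrite antipodel -scalerAr mulr1 linearZ.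
  under [LHS]eq_tsum => z1 z' do rewrite tsum_exchange.
  rewrite [LHS]tsum_exchange; apply: eq_tsumk => s v.
  apply: eq_tsumk => z1 z'; apply: eq_tsumk => z2 z3.
  by rewrite antipodeM !mulrA.
Qed.

Fact dual_braided_commutative : braided_commutative dual_act dual_coact.
Proof.
split; first exact: dual_drinfeld_yetter.
- move=> a b h; apply: dualP => x; rewrite dual_actE dualME.
  rewrite (coprodM_fun (W := k^o)); [|by move=> ?; lin_tac|by move=> ?; lin_tac].
  rewrite /= dual_tsumE; apply: eq_tsumk => h1 h2; rewrite dualME.
  by apply: eq_tsumk => x1 x2; rewrite !dual_actE.
- move=> h; apply: dualP => x.
  by rewrite dual_actE dualZ !dual1E counitM.
- move=> a b; apply: contr_ext => c; rewrite dual_coactE -dual_ad_mul.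
  rewrite (lin_tsumE _ _ (contr_lin c)).
  transitivity (\T_(x, h <- dual_coact a) \T_(y, g <- dual_coact b)
    \T_(c1, c2 <- coprod c) ((c1 h *: x) * (c2 g *: y))); last first.
    apply: eq_tsum => x h; rewrite (lin_tsumE _ _ (contr_lin c)).
    apply: eq_tsum => y g; rewrite contr_tens -dual_coprodE.
    rewrite (lin_tsumE _ _ (f := fun s : k^o => s *: (x * y))); last by lin_tac.
    by apply: eq_tsum => c1 c2; rewrite -scalerAl -scalerAr scalerA.
  under [RHS]eq_tsum => x h do rewrite tsum_exchange.
  rewrite [RHS]tsum_exchange; apply: eq_tsum => c1 c2.
  rewrite -(dual_coactE a) -(dual_coactE b) /contr.
  rewrite (lin_tsumE _ _ (f := fun s => s * _)); last by lin_tac.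
  apply: eq_tsum => x h; rewrite (lin_tsumE _ _ (f := fun s => _ * s)) //.
  by lin_tac.
- apply: contr_ext => c; rewrite dual_coactE contr_tens /dual_ad.
  by under eq_tsum do rewrite mulr1; rewrite antipoder.
- move=> a b; transitivity (\T_(a1, a2 <- coprod a) (dual_ad a1 b * a2)).
    transitivity (\T_(p, r <- coprod a) \T_(q, s <- coprod r)
      (p * b * (antipode q * s))).
      rewrite -[a in LHS]counitr.
      rewrite [LHS](lin_tsumE _ _ (f := fun s => s * b)); last by lin_tac.
      apply: eq_tsum => p r.
      rewrite -(lin_tsumE _ _ (f := fun s => p * b * s)); last by lin_tac.
      by rewrite antipodel -scalerAr mulr1 scalerAl.
    rewrite -(coprodA_fun a (F := fun p q s => p * b * (antipode q * s)));
      try by move=> *; lin_tac.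
    apply: eq_tsum => a1 a2; rewrite (lin_tsumE _ _ (f := fun s => s * _));
      last by lin_tac.
    by apply: eq_tsum => p q; rewrite !mulrA.
  transitivity (\T_(a1, a2 <- coprod a) \T_(x, h <- dual_coact b)
    (x * (a1 h *: a2))).
    apply: eq_tsum => a1 a2; rewrite -dual_coactE.
    rewrite (lin_tsumE _ _ (f := fun s => s * _)); last by lin_tac.
    by apply: eq_tsum => x h; rewrite -scalerAl -scalerAr.
  rewrite tsum_exchange; apply: eq_tsum => x h.
  by rewrite (lin_tsumE _ _ (f := fun s => _ * s)) //; lin_tac.
Qed.

Definition dual_bcAlg : bcAlgType H := BcAlgType dual_braided_commutative.

End DualBraidedCommutative.
Section TwistData.
Variables (k : fieldType) (H : hopfAlgType k).
Implicit Types delta : dual (H ⊗ H)%type.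

(* delta = delta^1 (x) delta^2 in H^* (x) H^*.                                 *)
Definition dual_pair delta : (dual H ⊗ dual H)%type :=
  dual_tensor (fun h g => delta (h ⊗ g)).

Lemma dual_pairE delta h g :
  \T_(d1, d2 <- dual_pair delta) (d1 h * d2 g : k^o) = delta (h ⊗ g).
Proof.
apply: (dual_tensorE (f := fun h g => delta (h ⊗ g))) => x /=.
  by apply: (lin_comp (f := fun h => h ⊗ x) (lin_scalar delta)); lin_tac.
by apply: (lin_comp (f := fun g => x ⊗ g) (lin_scalar delta)); lin_tac.
Qed.

(* The units of the algebra dual (H (x) H) are the convolution-invertible maps. *)
Lemma dual_unitP delta :
  reflect (exists delta' : dual (H ⊗ H)%type,
      delta * delta' = 1 /\ delta' * delta = 1)
    (delta \is a GRing.unit).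
Proof.
apply: (iffP idP) => [u|[d' [dd' d'd]]]; last by apply/unitrP; exists d'.
by exists delta^-1; rewrite mulrV // mulVr.
Qed.

Lemma dual_tensME (d d' : dual (H ⊗ H)%type) h g : (d * d') (h ⊗ g) =
  \T_(h1, h2 <- coprod h) \T_(g1, g2 <- coprod g)
    (d (h1 ⊗ g1) * d' (h2 ⊗ g2) : k^o).
Proof. by rewrite dualME; apply: (conv_tensE (A := k^o)); apply: lin_scalar. Qed.

Record twist_datum delta : Prop := {
  twist_unit : delta \is a GRing.unit;
  twist_unitr : forall h : H, delta (h ⊗ 1) = counit h;
  twist_unitl : forall h : H, delta (1 ⊗ h) = counit h;
  twist_act : forall g h : H,
    \Sw[2]_(g1 g2 <- g) \Sw[2]_(h1 h2 <- h)
      (delta (h1 ⊗ g1) *: (g2 * h2))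
    = \Sw[2]_(g1 g2 <- g) \Sw[2]_(h1 h2 <- h)
      (delta (h2 ⊗ g2) *: (g1 * h1));
  twist_act_coact : forall f g h : H,
    \Sw[4]_(f1 f2 f3 f4 <- f) \Sw[2]_(g1 g2 <- g) \Sw[4]_(h1 h2 h3 h4 <- h)
      ((delta (f1 ⊗ h1) * delta ((h2 * f2) ⊗ g1)
        * delta^-1 (f3 ⊗ (g2 * h3))) *: (h4 * f4))
    = \Sw[8]_(f1 f2 f3 f4 f5 f6 f7 f8 <- f) \Sw[2]_(g1 g2 <- g)
      \Sw[8]_(h1 h2 h3 h4 h5 h6 h7 h8 <- h)
      ((delta (f6 ⊗ h6)
        * delta ((h7 * f7) ⊗ (g1 * h1 * f1 * antipode f5 * antipode h5))
        * delta^-1 (f8 ⊗ (g2 * h2 * f2 * antipode f4 * antipode h4 * h8)))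
       *: (h3 * f3));
  twist_coact : forall f g h : H,
    \Sw[4]_(f1 f2 f3 f4 <- f) \Sw[2]_(g1 g2 <- g) \Sw[3]_(h1 h2 h3 <- h)
      ((delta (f1 ⊗ h1) * delta ((h2 * f2) ⊗ g1)
        * delta^-1 (f3 ⊗ (g2 * h3))) *: f4)
    = \Sw[10]_(f1 f2 f3 f4 f5 f6 f7 f8 f9 f10 <- f) \Sw[2]_(g1 g2 <- g)
      \Sw[3]_(h1 h2 h3 <- h)
      ((delta (f8 ⊗ (h1 * f1 * antipode f7))
        * delta ((h2 * f2 * antipode f6 * f9) ⊗ g1)
        * delta^-1 (f10 ⊗ (g2 * h3 * f3 * antipode f5))) *: f4) }.

(* gamma_delta(g, h) = <delta^2 delta^1'_(1) deltabar^2_(2), g>                *)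
(*    <delta^2' deltabar^2_(1), h> delta^1 delta^1'_(2) deltabar^1             *)
Definition twist_cocycle_fun delta (g h : H) : dual H :=
  \T_(d1, d2 <- dual_pair delta) \T_(d1', d2' <- dual_pair delta)
  \T_(e1, e2 <- dual_pair delta^-1)
  \Sw[2]_(p1 p2 <- d1') \Sw[2]_(q1 q2 <- e2)
    (((d2 * p1 * q2) g * (d2' * q1) h) *: (d1 * p2 * e1)).

Definition twist_cocycle delta (t : (H ⊗ H)%type) : dual H :=
  \T_(g, h <- t) twist_cocycle_fun delta g h.

Fact twist_cocycle_linear delta : linear (twist_cocycle delta).
Proof. by rewrite /twist_cocycle /twist_cocycle_fun /=; lin_tac. Qed.
HB.instance Definition _ delta :=
  GRing.isLinear.Build k _ _ _ (twist_cocycle delta) (twist_cocycle_linear delta).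

Lemma twist_cocycleE delta g h :
  twist_cocycle delta (g ⊗ h) = twist_cocycle_fun delta g h.
Proof.
by rewrite /twist_cocycle tsum_tens // => ?; rewrite /twist_cocycle_fun /=; lin_tac.
Qed.

End TwistData.

(* Main.v *)
From HB Require Import structures.
Require Import Defs.
From mathcomp Require Import all_boot all_order all_algebra all_field.

Set Implicit Arguments.
Unset Strict Implicit.
Unset Printing Implicit Defensive.

Import GRing.Theory.
Local Open Scope ring_scope.

(** A map gamma from H ⊗ H to H^* is the same as a trilinear form on H,
    Gam(h, g; x) = <gamma(h ⊗ g), x>, that is, an element of the convolution
    algebra dual to H ⊗ H ⊗ H.  Since the product of H^* is dual to the
    coproduct of H, the clauses defining a 2-cocycle turn into identities
    between such forms ([Z2_cocycle_form]).  The cocycle identity becomes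

      Gam(g1, f1; h1 x1) Gam(h2, f2 g2; x2) = Gam(h1, g1; x1) Gam(g2 h2, f; x2),

    with Sweedler indices.  Put delta(h, g) = Gam(h, g; 1).  At x = 1 this reads
    Gam(g1, f1; h1) delta(h2, f2 g2) = delta(h1, g1) delta(g2 h2, f), and since
    delta is convolution-invertible,

      Gam(g, h; x) = delta(x1, g1) delta(g2 x2, h1) delta^-1(x3, h2 g3),

    which is the cocycle of delta ([cocycle_form_twist], [twist_cocycle_form]).
    Evaluation at x = 1 returns delta ([twist_form_at_one]), so that gamma and
    delta determine each other.

    It remains to see that the conditions on gamma and on delta match.  The
    condition [twist_act] says that delta commutes, in the convolution algebra,
    with the functionals h ⊗ g |-> b(g h).  Hence the first factor of Gam slides
    past its other factors, even after products are substituted for the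
    variables.  This gives the compatibility of gamma with the action
    ([twist_form_comm]); in the cocycle identity it lets one factor of each
    side meet its inverse, and both sides reduce to the same product of four
    factors ([twist_form_cocycle]).

    The two clauses involving the coaction are quantified over b in H^*.  The
    coaction satisfies <b_(0), x> b_(1) = <b, x2> x1 S(x3) ([dual_coact_sum]),
    so b can be stripped off, and they become identities in H,

      Gam(h, g; x1) x2 = Gam(h x1 S(x3), g; x4) x2,
      Gam(h1, g; x1) h2 x2 = Gam(h4, g h1 x1 S(h3 x3); x4) h2 x2.

    With the formula for Gam, and with the coproducts of the arguments expanded
    (the antipode reverses the coproduct), these are [twist_coact] and
    [twist_act_coact].

    Substituting products for variables in a form is pulling back along a
    coalgebra map, and pullback is a morphism of convolution algebras
    ([pullM]).  The algebraic clauses are therefore proved in the rings dual to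
    H ⊗ H ⊗ H and H ⊗ H ⊗ H ⊗ H; only the two clauses with the antipode need
    manipulations of iterated coproducts. *)

(** * Sums over tensors and coproducts *)

Section TsumScale.
Variables (k : fieldType) (U : lmodType k) (V : vectType k) (W : lmodType k).
Implicit Types t : (U ⊗ V)%type.

Lemma tsum_scalel t (F : U -> V -> k^o) (w : W) :
  (tsum t F : k) *: w = \T_(x, y <- t) (F x y *: w).
Proof. exact: scaler_suml. Qed.

Lemma tsum_scaler t (F : U -> V -> W) (c : k) :
  c *: tsum t F = \T_(x, y <- t) (c *: F x y).
Proof. exact: scaler_sumr. Qed.

End TsumScale.

Section TensorScale.
Variables (k : fieldType) (U : lmodType k) (V : vectType k).
Lemma tensZl (a : k) (u : U) (v : V) : (a *: u) ⊗ v = a *: (u ⊗ v).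
Proof. by rewrite (linZ (f := fun u => u ⊗ v)) //; lin_tac. Qed.
Lemma tensZr (a : k) (u : U) (v : V) : u ⊗ (a *: v) = a *: (u ⊗ v).
Proof. by rewrite (linZ (f := fun v => u ⊗ v)) //; lin_tac. Qed.
End TensorScale.

Section Counit.
Variables (k : fieldType) (C : nzCoalgType k) (W : lmodType k).

Lemma counit_suml (c : C) : \T_(c1, c2 <- coprod c) (counit c1 * counit c2 : k^o)
  = counit c :> k.
Proof.
rewrite -[in RHS](counitl c) [RHS](lin_tsumE _ _ (lin_scalar counit)).
by apply: eq_tsumk => c1 c2; rewrite linearZ.
Qed.

Lemma counitl_fun (c : C) (F : C -> W) : lin F ->
  \T_(c1, c2 <- coprod c) (counit c1 *: F c2) = F c.
Proof.
move=> hF; rewrite -[c in RHS]counitl (lin_tsumE _ _ hF).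
by apply: eq_tsum => c1 c2; rewrite (linZ hF).
Qed.

End Counit.

Lemma tsum_coprod_tens (k : fieldType) (C D : nzCoalgType k) (W : lmodType k)
    (G : (C ⊗ D)%type -> (C ⊗ D)%type -> W) c d :
  (forall y, lin (G^~ y)) -> (forall x, lin (G x)) ->
  tsum (coprod (c ⊗ d)) G = \T_(c1, c2 <- coprod c) \T_(d1, d2 <- coprod d)
    G (c1 ⊗ d1) (c2 ⊗ d2).
Proof.
move=> hl hr; rewrite [coprod _]tensor_coprodE.
rewrite (lin_tsumE _ _ (f := fun s => tsum s G)); last by lin_tac.
apply: eq_tsum => c1 c2.
rewrite (lin_tsumE _ _ (f := fun s => tsum s G)); last by lin_tac.
by apply: eq_tsum => d1 d2; rewrite tsum_tens.
Qed.

(** * Coalgebra maps and pullback of functionals *)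

Section CoalgebraMaps.
Variable k : fieldType.

Record comap (C D : nzCoalgType k) : Type := Comap {
  cofun :> C -> D;
  comap_lin : lin cofun;
  comap_coprod : forall c,
    coprod (cofun c) = \T_(x, y <- coprod c) cofun x ⊗ cofun y;
  comap_counit : forall c, counit (cofun c) = counit c }.

Definition pull (C D : nzCoalgType k) (p : comap C D) (a : dual D) : dual C :=
  dual_of (fun c => a (p c)).

Lemma pullE (C D : nzCoalgType k) (p : comap C D) a c : pull p a c = a (p c).
Proof.
by rewrite /pull dual_ofE //; apply: lin_comp (lin_scalar a) (comap_lin p).
Qed.

Section Pull.
Variables (C D : nzCoalgType k) (p : comap C D).

Lemma tsum_comap (W : lmodType k) (F : D -> D -> W) c :
  (forall y, lin (F^~ y)) -> (forall x, lin (F x)) ->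
  tsum (coprod (p c)) F = \T_(x, y <- coprod c) F (p x) (p y).
Proof.
move=> hl hr; rewrite comap_coprod (lin_tsumE _ _ (f := fun s => tsum s F)).
  by apply: eq_tsum => x y; rewrite tsum_tens.
by lin_tac.
Qed.

(** This is how every product of forms is computed after a substitution of
    variables: convolution is dual to the coproduct, which p preserves. *)
Lemma pullM : {morph pull p : a b / a * b}.
Proof.
move=> a b; apply: dualP => c; rewrite pullE !dualME.
rewrite (tsum_comap (W := k^o)); try by move=> ?; lin_tac.
by apply: eq_tsumk => x y; rewrite !pullE.
Qed.

Lemma pull1 : pull p 1 = 1.
Proof. by apply: dualP => c; rewrite pullE !dual1E comap_counit. Qed.

Lemma pull_unit a : a \is a GRing.unit -> pull p a \is a GRing.unit.
Proof.
move=> ua; apply/unitrP; exists (pull p a^-1).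
by rewrite -!pullM mulVr // mulrV // pull1.
Qed.

Lemma pullV a : a \is a GRing.unit -> pull p a^-1 = (pull p a)^-1.
Proof.
move=> ua; apply: (mulrI (pull_unit ua)).
by rewrite -pullM !mulrV ?pull1 // pull_unit.
Qed.

Lemma pull_comm a b : GRing.comm a b -> GRing.comm (pull p a) (pull p b).
Proof. by move=> ab; rewrite /GRing.comm -!pullM ab. Qed.

Lemma pull_sum (X : lmodType k) (Y : vectType k) (t : (X ⊗ Y)%type) F :
  pull p (tsum t F) = \T_(x, y <- t) pull p (F x y).
Proof.
apply: dualP => c; rewrite pullE !dual_tsumE.
by apply: eq_tsumk => x y; rewrite pullE.
Qed.

End Pull.

Section Constructions.
Variables C D E : nzCoalgType k.

Fact coid_coprod (c : C) : coprod c = \T_(x, y <- coprod c) x ⊗ y.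
Proof. by rewrite tsum_eta. Qed.
Definition coid : comap C C :=
  Comap (@lin_id _ _) coid_coprod (fun=> erefl).

Section Comp.
Variables (p : comap D E) (q : comap C D).
Fact cocomp_coprod c :
  coprod (p (q c)) = \T_(x, y <- coprod c) p (q x) ⊗ p (q y).
Proof.
have hp := comap_lin p.
by rewrite comap_coprod tsum_comap // => ?; lin_tac.
Qed.
Fact cocomp_counit c : counit (p (q c)) = counit c.
Proof. by rewrite !comap_counit. Qed.
Definition cocomp : comap C E :=
  Comap (lin_comp (comap_lin p) (comap_lin q)) cocomp_coprod cocomp_counit.
End Comp.

(** Coalgebra maps out of C ⊗ D are given by bilinear maps, so that their
    properties and values need only be known on pure tensors. *)
Section Bilinear.
Variable F : C -> D -> E.
Hypotheses (Fl : forall d, lin (F^~ d)) (Fr : forall c, lin (F c)).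
Hypothesis Fcoprod : forall c d, coprod (F c d) =
  \T_(c1, c2 <- coprod c) \T_(d1, d2 <- coprod d) F c1 d1 ⊗ F c2 d2.
Hypothesis Fcounit : forall c d, counit (F c d) = counit c * counit d.

Let f (t : (C ⊗ D)%type) : E := tsum t F.
Fact cobil_lin : lin f. Proof. by rewrite /f; lin_tac. Qed.
Fact cobil_subE c d : f (c ⊗ d) = F c d.
Proof. by rewrite /f tsum_tens. Qed.
Fact cobil_coprod t : coprod (f t) = \T_(x, y <- coprod t) f x ⊗ f y.
Proof.
have hf := cobil_lin.
move: t; apply: tensor_lin_ext => [||c d]; [by lin_tac|by lin_tac|].
rewrite cobil_subE Fcoprod tsum_coprod_tens; try by move=> ?; lin_tac.
by apply: eq_tsum => c1 c2; apply: eq_tsum => d1 d2; rewrite !cobil_subE.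
Qed.
Fact cobil_counit t : counit (f t) = counit t.
Proof.
have hf := cobil_lin.
move: t; apply: (tensor_lin_ext (W := k^o)) => [||c d]; [by lin_tac|by lin_tac|].
by rewrite cobil_subE Fcounit [RHS]tensor_counitE.
Qed.
Definition cobil : comap (C ⊗ D)%type E :=
  Comap cobil_lin cobil_coprod cobil_counit.
Lemma cobilE c d : cobil (c ⊗ d) = F c d.
Proof. exact: cobil_subE. Qed.
End Bilinear.

End Constructions.
End CoalgebraMaps.

Section Blocks.
Variable k : fieldType.
Implicit Types C D E : nzCoalgType k.

Section Cotens.
Variables (C C' D D' : nzCoalgType k) (p : comap C C') (q : comap D D').
Fact cotens_linl d : lin (fun c => p c ⊗ q d).
Proof. by have hp := comap_lin p; lin_tac. Qed.
Fact cotens_linr c : lin (fun d => p c ⊗ q d).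
Proof. by have hq := comap_lin q; lin_tac. Qed.
Fact cotens_coprod c d : coprod (p c ⊗ q d) =
  \T_(c1, c2 <- coprod c) \T_(d1, d2 <- coprod d)
    (p c1 ⊗ q d1) ⊗ (p c2 ⊗ q d2).
Proof.
have hq := comap_lin q.
rewrite [LHS]tensor_coprodE tsum_comap; try by move=> ?; lin_tac.
by apply: eq_tsum => c1 c2; rewrite tsum_comap // => ?; lin_tac.
Qed.
Fact cotens_counit c d : counit (p c ⊗ q d) = counit c * counit d.
Proof. by rewrite [LHS]tensor_counitE !comap_counit. Qed.
Definition cotens := cobil cotens_linl cotens_linr cotens_coprod cotens_counit.
Lemma cotensE c d : cotens (c ⊗ d) = p c ⊗ q d.
Proof. exact: cobilE. Qed.
End Cotens.

Section Coswap.
Variables C D : nzCoalgType k.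
Fact coswap_linl (d : D) : lin (fun c : C => d ⊗ c).
Proof. by lin_tac. Qed.
Fact coswap_linr (c : C) : lin (fun d : D => d ⊗ c).
Proof. by lin_tac. Qed.
Fact coswap_coprod (c : C) (d : D) : coprod (d ⊗ c) =
  \T_(c1, c2 <- coprod c) \T_(d1, d2 <- coprod d) (d1 ⊗ c1) ⊗ (d2 ⊗ c2).
Proof. by rewrite [LHS]tensor_coprodE tsum_exchange. Qed.
Fact coswap_counit (c : C) (d : D) : counit (d ⊗ c) = counit c * counit d.
Proof. by rewrite [LHS]tensor_counitE mulrC. Qed.
Definition coswap := cobil coswap_linl coswap_linr coswap_coprod coswap_counit.
Lemma coswapE c d : coswap (c ⊗ d) = d ⊗ c.
Proof. exact: cobilE. Qed.
End Coswap.

(** Discarding a variable is a coalgebra map only when it is done by the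
    counit. *)
Section Coforget.
Variables C D : nzCoalgType k.
Fact coforget_linl (d : D) : lin (fun c : C => counit c *: d).
Proof. by lin_tac. Qed.
Fact coforget_linr (c : C) : lin (fun d : D => counit c *: d).
Proof. by lin_tac. Qed.

Fact coforget_coprod (c : C) (d : D) : coprod (counit c *: d) =
  \T_(c1, c2 <- coprod c) \T_(d1, d2 <- coprod d)
     (counit c1 *: d1) ⊗ (counit c2 *: d2).
Proof.
rewrite linearZ -[in LHS](tsum_eta (coprod d)) -counit_suml [LHS]tsum_scalel.
apply: eq_tsum => c1 c2.
rewrite [LHS]tsum_scaler; apply: eq_tsum => d1 d2.
rewrite (linZ (f := fun u => u ⊗ _)); last by lin_tac.
by rewrite (linZ (f := fun u => _ ⊗ u)) ?scalerA //; lin_tac.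
Qed.
Fact coforget_counit (c : C) (d : D) :
  counit (counit c *: d) = counit c * counit d.
Proof. exact: linearZ. Qed.
Definition coforget :=
  cobil coforget_linl coforget_linr coforget_coprod coforget_counit.
Lemma coforgetE c d : coforget (c ⊗ d) = counit c *: d.
Proof. exact: cobilE. Qed.
End Coforget.

Section Coassoc.
Variables C D E : nzCoalgType k.
Let F (t : (C ⊗ D)%type) (e : E) : (C ⊗ (D ⊗ E))%type :=
  \T_(c, d <- t) c ⊗ (d ⊗ e).
Let FE c d e : F (c ⊗ d) e = c ⊗ (d ⊗ e).
Proof. by rewrite /F tsum_tens // => ?; lin_tac. Qed.
Fact coassoc_linl e : lin (F^~ e).
Proof. by rewrite /F; lin_tac. Qed.
Fact coassoc_linr t : lin (F t).
Proof. by rewrite /F; lin_tac. Qed.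
Fact coassoc_coprod t e : coprod (F t e) =
  \T_(t1, t2 <- coprod t) \T_(e1, e2 <- coprod e) F t1 e1 ⊗ F t2 e2.
Proof.
have hl := coassoc_linl; have hr := coassoc_linr.
move: t; apply: tensor_lin_ext => [||c d]; [by lin_tac|by lin_tac|].
rewrite FE [LHS]tensor_coprodE tsum_coprod_tens; try by move=> ?; lin_tac.
apply: eq_tsum => c1 c2; rewrite tsum_coprod_tens; try by move=> ?; lin_tac.
apply: eq_tsum => d1 d2; apply: eq_tsum => e1 e2; by rewrite !FE.
Qed.
Fact coassoc_counit t e : counit (F t e) = counit t * counit e.
Proof.
have hl := coassoc_linl.
move: t; apply: (tensor_lin_ext (W := k^o)) => [||c d]; [by lin_tac|by lin_tac|].
rewrite FE [LHS]tensor_counitE.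
by rewrite [counit (d ⊗ e)]tensor_counitE [counit (c ⊗ d)]tensor_counitE mulrA.
Qed.
Definition coassoc :=
  cobil coassoc_linl coassoc_linr coassoc_coprod coassoc_counit.
Lemma coassocE c d e : coassoc (c ⊗ d ⊗ e) = c ⊗ (d ⊗ e).
Proof. by rewrite cobilE FE. Qed.
End Coassoc.

Section HopfBlocks.
Variable H : hopfAlgType k.
Fact comul_linl (g : H) : lin (fun h : H => h * g). Proof. by lin_tac. Qed.
Fact comul_linr (h : H) : lin (fun g : H => h * g). Proof. by lin_tac. Qed.
Definition comul : comap (H ⊗ H)%type H :=
  cobil comul_linl comul_linr (@coprodM k H) (@counitM k H).
Lemma comulE h g : comul (h ⊗ g) = h * g.
Proof. exact: cobilE. Qed.

Variable C : nzCoalgType k.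
Fact coins1_lin : lin (fun c : C => c ⊗ (1 : H)).
Proof. by lin_tac. Qed.
Fact coins1_coprod (c : C) : coprod (c ⊗ (1 : H)) =
  \T_(x, y <- coprod c) (x ⊗ 1) ⊗ (y ⊗ 1).
Proof.
rewrite [LHS]tensor_coprodE; apply: eq_tsum => c1 c2.
by rewrite coprod1 tsum_tens // => ?; lin_tac.
Qed.
Fact coins1_counit (c : C) : counit (c ⊗ (1 : H)) = counit c.
Proof. by rewrite [LHS]tensor_counitE counit1 mulr1. Qed.
(** The unit is group-like, so setting a variable to 1 is a coalgebra map. *)
Definition coins1 : comap C (C ⊗ H)%type :=
  Comap coins1_lin coins1_coprod coins1_counit.
End HopfBlocks.

End Blocks.

(** * Functionals on tensor products *)

Section TensorFunctionals.
Variable k : fieldType.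

Section Dten.
Variables C D : nzCoalgType k.
Implicit Types (a : dual C) (b : dual D).
(** The functional a ⊗ b; these span the dual of C ⊗ D ([dten_split]). *)
Definition dten a b : dual (C ⊗ D)%type :=
  dual_of (fun t => \T_(c, d <- t) (a c * b d : k^o)).

Lemma dtenE a b c d : dten a b (c ⊗ d) = a c * b d.
Proof.
rewrite dual_ofE; last by lin_tac.
by rewrite (tsum_tens (W := k^o)) // => ?; lin_tac.
Qed.

Lemma dual_tensP (u v : dual (C ⊗ D)%type) :
  (forall c d, u (c ⊗ d) = v (c ⊗ d)) -> u = v.
Proof.
move=> uv; apply: dualP; apply: (tensor_lin_ext (W := k^o)) => //; exact: lin_scalar.
Qed.

Lemma dual_tens_mulE (u v : dual (C ⊗ D)%type) c d : (u * v) (c ⊗ d) =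
  \T_(c1, c2 <- coprod c) \T_(d1, d2 <- coprod d)
    (u (c1 ⊗ d1) * v (c2 ⊗ d2) : k^o).
Proof. by rewrite dualME; apply: (conv_tensE (A := k^o)); apply: lin_scalar. Qed.

Lemma dtenM a b a' b' : dten a b * dten a' b' = dten (a * a') (b * b').
Proof.
apply: dual_tensP => c d; rewrite dual_tens_mulE dtenE !dualME.
rewrite tsum_mull; apply: eq_tsumk => c1 c2; rewrite tsum_mulr.
by apply: eq_tsumk => d1 d2; rewrite !dtenE mulrACA.
Qed.

Definition dsplit (u : dual (C ⊗ D)%type) : (dual C ⊗ dual D)%type :=
  dual_tensor (fun c d => u (c ⊗ d)).

Lemma dsplitE u c d :
  \T_(a, b <- dsplit u) (a c * b d : k^o) = u (c ⊗ d).
Proof.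
apply: (dual_tensorE (f := fun c d => u (c ⊗ d))) => x /=.
  by apply: (lin_comp (f := fun c => c ⊗ x) (lin_scalar u)); lin_tac.
by apply: (lin_comp (f := fun d => x ⊗ d) (lin_scalar u)); lin_tac.
Qed.

Lemma dten_split u : \T_(a, b <- dsplit u) dten a b = u.
Proof.
apply: dual_tensP => c d; rewrite dual_tsumE -dsplitE.
by apply: eq_tsumk => a b; rewrite dtenE.
Qed.
End Dten.

Lemma pull_cotens (C C' D D' : nzCoalgType k) (p : comap C C') (q : comap D D') a b :
  pull (cotens p q) (dten a b) = dten (pull p a) (pull q b).
Proof. by apply: dual_tensP => c d; rewrite pullE cotensE !dtenE !pullE. Qed.

(** Functionals of disjoint sets of variables commute.  So a functional u of
    the second variable commutes with a form in which that variable occurs only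
    through p as soon as u commutes with all functionals pulled back by p. *)
Lemma dten_comm (C C' D D' : nzCoalgType k) (q : comap C C') (p : comap D D')
    (u : dual D) (v : dual (C' ⊗ D')%type) :
  (forall b, GRing.comm u (pull p b)) ->
  GRing.comm (dten 1 u) (pull (cotens q p) v).
Proof.
move=> up; rewrite -[v]dten_split pull_sum.
apply: commr_sum => i _; rewrite pull_cotens /GRing.comm !dtenM up.
by rewrite mul1r mulr1.
Qed.

End TensorFunctionals.

Section PureTensors.
Variables (k : fieldType) (C D E F : nzCoalgType k).

Lemma dual_tens3P (u v : dual (C ⊗ D ⊗ E)%type) :
  (forall c d e, u (c ⊗ d ⊗ e) = v (c ⊗ d ⊗ e)) -> u = v.
Proof.
move=> uv; apply: dual_tensP => t e; move: t.
apply: (tensor_lin_ext (W := k^o)) => [||c d]; [by lin_tac|by lin_tac|exact: uv].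
Qed.

Lemma dual_tens4P (u v : dual (C ⊗ D ⊗ E ⊗ F)%type) :
  (forall c d e f, u (c ⊗ d ⊗ e ⊗ f) = v (c ⊗ d ⊗ e ⊗ f)) -> u = v.
Proof.
move=> uv; apply: dual_tensP => t f; move: t.
apply: (tensor_lin_ext (W := k^o)) => [||t e]; [by lin_tac|by lin_tac|move: t].
apply: (tensor_lin_ext (W := k^o)) => [||c d]; [by lin_tac|by lin_tac|exact: uv].
Qed.

Lemma dual_tens3_mulE (u v : dual (C ⊗ D ⊗ E)%type) c d e :
  (u * v) (c ⊗ d ⊗ e) =
  \T_(c1, c2 <- coprod c) \T_(d1, d2 <- coprod d) \T_(e1, e2 <- coprod e)
    (u (c1 ⊗ d1 ⊗ e1) * v (c2 ⊗ d2 ⊗ e2) : k^o).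
Proof.
rewrite dual_tens_mulE (tsum_coprod_tens (W := k^o)) //; by move=> ?; lin_tac.
Qed.

Lemma dual_tens4_mulE (u v : dual (C ⊗ D ⊗ E ⊗ F)%type) c d e f :
  (u * v) (c ⊗ d ⊗ e ⊗ f) =
  \T_(c1, c2 <- coprod c) \T_(d1, d2 <- coprod d) \T_(e1, e2 <- coprod e)
  \T_(f1, f2 <- coprod f)
    (u (c1 ⊗ d1 ⊗ e1 ⊗ f1) * v (c2 ⊗ d2 ⊗ e2 ⊗ f2) : k^o).
Proof.
rewrite dual_tens_mulE (tsum_coprod_tens (W := k^o)); try by move=> ?; lin_tac.
rewrite (tsum_coprod_tens (W := k^o)) //; by move=> ?; lin_tac.
Qed.

End PureTensors.

Section Currying.
Variables (k : fieldType) (C D : nzCoalgType k).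

Definition curry (u : dual (C ⊗ D)%type) (c : C) : dual D :=
  dual_of (fun d => u (c ⊗ d)).

Lemma curryE u c d : curry u c d = u (c ⊗ d).
Proof. by rewrite dual_ofE //; lin_tac. Qed.

Fact curry_linear u : linear (curry u).
Proof.
move=> a c c'; apply: dualP => d; rewrite dualD dualZ !curryE.
have hl : lin (V := k^o) (fun c => u (c ⊗ d)) by lin_tac.
exact: hl.
Qed.
HB.instance Definition _ u :=
  GRing.isLinear.Build k _ _ _ (curry u) (curry_linear u).

Definition uncurry (f : C -> dual D) : dual (C ⊗ D)%type :=
  dual_of (fun t => \T_(c, d <- t) (f c d : k^o)).

Lemma uncurryE f c d : lin f -> uncurry f (c ⊗ d) = f c d.
Proof.
move=> hf; rewrite dual_ofE; last by lin_tac.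
by rewrite (tsum_tens (W := k^o)) // => ?; lin_tac.
Qed.

Lemma uncurryM (f g : C -> dual D) : lin f -> lin g ->
  uncurry f * uncurry g = uncurry (conv f g).
Proof.
move=> hf hg; apply: dual_tensP => c d.
rewrite uncurryE; last exact: conv_lin.
rewrite dual_tens_mulE dual_tsumE; apply: eq_tsumk => c1 c2.
by rewrite dualME; apply: eq_tsumk => d1 d2; rewrite !uncurryE.
Qed.

Lemma uncurry_conv_unit : uncurry (conv_unit (dual D)) = 1.
Proof.
apply: dual_tensP => c d; rewrite uncurryE; last exact: conv_unit_lin.
by rewrite dualZ !dual1E [RHS]tensor_counitE.
Qed.

Lemma eq_uncurry f g : f =1 g -> lin f -> uncurry f = uncurry g.
Proof.
move=> fg hf; have hg : lin g by move=> a x y; rewrite -!fg hf.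
by apply: dual_tensP => c d; rewrite !uncurryE // fg.
Qed.

Lemma curryK u : uncurry (curry u) = u.
Proof.
by apply: dual_tensP => c d; rewrite uncurryE ?curryE //; apply: linE.
Qed.

(** Currying identifies the convolution algebra of maps C -> D^* with the dual
    of C ⊗ D. *)
Lemma conv_invertible_uncurry (f : {linear C -> dual D}) :
  conv_invertible f <-> uncurry f \is a GRing.unit.
Proof.
have hf := linE f; split=> [[g [fg gf]]|u].
  have hg := linE g.
  apply/unitrP; exists (uncurry g); rewrite !uncurryM // -uncurry_conv_unit.
  by split; apply: eq_uncurry => //; apply: conv_lin.
exists (curry (uncurry f)^-1).
suff E (p q : {linear C -> dual D}) : uncurry p * uncurry q = 1 ->
    conv p q =1 conv_unit _.
  by split; apply: E; rewrite curryK ?mulrV ?mulVr.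
move=> pq c; apply: dualP => d.
have hp := linE p; have hq := linE q.
rewrite -uncurryE; last exact: conv_lin.
by rewrite -uncurryM // pq -uncurry_conv_unit uncurryE //; apply: conv_unit_lin.
Qed.

End Currying.

(** * The functional of a twist and its cocycle identity *)

(** The shape of the cocycle identity: d and e meet their inverses once a has
    moved to the left. *)
Lemma slide_cancel (R : unitRingType) (a b c d e z : R) :
  GRing.comm a b -> GRing.comm a c -> GRing.comm a d ->
  d \is a GRing.unit -> e \is a GRing.unit ->
  b * c / d * (a * d / z) = a * b / e * (e * c / z).
Proof.
move=> ab ac ad du eu; rewrite ad !mulrA !mulrVK //.
by rewrite -[b * c * a]mulrA -ac mulrA -ab.
Qed.

Section Legs.
Variables (k : fieldType) (H : hopfAlgType k).

Definition comulop : comap (H ⊗ H)%type H := cocomp (comul H) (coswap H H).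

(** The three legs are the arguments of the three factors of the form of a
    twist; their values on pure tensors are [leg1E], [leg2E] and [leg3E]. *)
Definition leg1 : comap (H ⊗ H ⊗ H)%type (H ⊗ H)%type :=
  cocomp (coswap _ _) (cotens (cocomp (coforget H H) (coswap H H)) (coid H)).
(** Brings together the variables g and x that the first two legs combine. *)
Definition shift : comap (H ⊗ H ⊗ H)%type (H ⊗ (H ⊗ H))%type :=
  cocomp (coassoc _ _ _) (cotens (coswap H H) (coid H)).
Definition leg2 : comap (H ⊗ H ⊗ H)%type (H ⊗ H)%type :=
  cocomp (coswap _ _) (cocomp (cotens (coid H) (comul H)) shift).
Definition leg3 : comap (H ⊗ H ⊗ H)%type (H ⊗ H)%type :=
  cocomp (coswap _ _) (cotens comulop (coid H)).

(** The argument h g x of b in the compatibility of a cocycle with the action,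
    obtained as the opposite product of the second leg, and also of the third
    one. *)
Definition total_mul : comap (H ⊗ H ⊗ H)%type H := cocomp comulop leg2.

Lemma cocompE (C D E : nzCoalgType k) (p : comap D E) (q : comap C D) c :
  cocomp p q c = p (q c).
Proof. by []. Qed.
Lemma comapZ (C D : nzCoalgType k) (p : comap C D) a c : p (a *: c) = a *: p c.
Proof. exact: linZ (comap_lin p) a c. Qed.
Lemma coidE (C : nzCoalgType k) c : coid C c = c.
Proof. by []. Qed.
Lemma coins1E (C : nzCoalgType k) c : coins1 H C c = c ⊗ 1.
Proof. by []. Qed.

Lemma comulopE h g : comulop (h ⊗ g) = g * h.
Proof. by rewrite cocompE coswapE comulE. Qed.

Let coE := (cocompE, coidE, coins1E, comulopE, coswapE, cotensE, coassocE,
  comulE, coforgetE).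

Lemma leg1E g h x : leg1 (g ⊗ h ⊗ x) = counit h *: (x ⊗ g).
Proof. by rewrite /leg1 !coE tensZr. Qed.
Lemma shiftE g h x : shift (g ⊗ h ⊗ x) = h ⊗ (g ⊗ x).
Proof. by rewrite /shift !coE. Qed.
Lemma leg2E g h x : leg2 (g ⊗ h ⊗ x) = (g * x) ⊗ h.
Proof. by rewrite /leg2 cocompE cocompE shiftE !coE. Qed.
Lemma leg3E g h x : leg3 (g ⊗ h ⊗ x) = x ⊗ (h * g).
Proof. by rewrite /leg3 !coE. Qed.
Lemma total_mulE g h x : total_mul (g ⊗ h ⊗ x) = h * (g * x).
Proof. by rewrite /total_mul cocompE leg2E comulopE. Qed.

(** The arguments of the four occurrences of the cocycle in the cocycle
    identity evaluated at x, see [clause_cocycle]. *)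
Definition face1 : comap (H ⊗ H ⊗ H ⊗ H)%type (H ⊗ H ⊗ H)%type :=
  cocomp (cotens (coswap H H) (comul H)) (coassoc _ _ _).
Definition face2 : comap (H ⊗ H ⊗ H ⊗ H)%type (H ⊗ H ⊗ H)%type :=
  cotens (cocomp (coswap _ _) (cotens (comul H) (coid H))) (coid H).
Definition face3 : comap (H ⊗ H ⊗ H ⊗ H)%type (H ⊗ H ⊗ H)%type :=
  cotens (cocomp (coswap _ _) (cotens (coforget H H) (coid H))) (coid H).
Definition face4 : comap (H ⊗ H ⊗ H ⊗ H)%type (H ⊗ H ⊗ H)%type :=
  cotens (cocomp (coswap _ _) (cocomp (cotens (coid H) (comul H)) (coassoc _ _ _)))
    (coid H).

Lemma face1E f g h x : face1 (f ⊗ g ⊗ h ⊗ x) = g ⊗ f ⊗ (h * x).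
Proof. by rewrite /face1 !coE. Qed.
Lemma face2E f g h x : face2 (f ⊗ g ⊗ h ⊗ x) = h ⊗ (f * g) ⊗ x.
Proof. by rewrite /face2 !coE. Qed.
Lemma face3E f g h x : face3 (f ⊗ g ⊗ h ⊗ x) = counit f *: (h ⊗ g ⊗ x).
Proof. by rewrite /face3 !coE tensZr tensZl. Qed.
Lemma face4E f g h x : face4 (f ⊗ g ⊗ h ⊗ x) = (g * h) ⊗ f ⊗ x.
Proof. by rewrite /face4 !coE. Qed.

Definition unitr_face : comap (H ⊗ H)%type (H ⊗ H ⊗ H)%type :=
  cotens (coins1 H H) (coid H).
Definition unitl_face : comap (H ⊗ H)%type (H ⊗ H ⊗ H)%type :=
  cotens (cocomp (coswap _ _) (coins1 H H)) (coid H).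
Lemma unitr_faceE h x : unitr_face (h ⊗ x) = h ⊗ 1 ⊗ x.
Proof. by rewrite /unitr_face !coE. Qed.
Lemma unitl_faceE h x : unitl_face (h ⊗ x) = 1 ⊗ h ⊗ x.
Proof. by rewrite /unitl_face !coE. Qed.

Definition at_one : comap (H ⊗ H)%type (H ⊗ H ⊗ H)%type :=
  coins1 H (H ⊗ H)%type.
Lemma at_oneE t : at_one t = t ⊗ 1.
Proof. by []. Qed.

Definition legE := (leg1E, leg2E, leg3E, total_mulE, face1E, face2E, face3E, face4E,
  unitr_faceE, unitl_faceE, at_oneE).

Variable delta : dual (H ⊗ H)%type.

(** delta(x1, g1) delta(g2 x2, h1) delta^-1(x3, h2 g3) at g ⊗ h ⊗ x. *)
Definition twist_form : dual (H ⊗ H ⊗ H)%type :=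
  pull leg1 delta * pull leg2 delta * pull leg3 delta^-1.

Section Twist.
Hypothesis delta_unit : delta \is a GRing.unit.

Lemma twist_form_unit : twist_form \is a GRing.unit.
Proof. by rewrite !unitrMl ?pull_unit ?unitrV. Qed.

Lemma pull_twist_form C (p : comap C _) :
  pull p twist_form = pull p (pull leg1 delta) * pull p (pull leg2 delta)
    * (pull p (pull leg3 delta))^-1.
Proof. by rewrite !pullM -!pullV // pull_unit. Qed.

Section Comm.
Hypothesis delta_comm : forall b, GRing.comm delta (pull comulop b).

(** The first factor delta(x, g) meets the second leg only through the product
    g x, with which it commutes by hypothesis. *)
Lemma leg1_comm v : GRing.comm (pull leg1 delta) (pull leg2 v).
Proof.
have -> : pull leg1 delta = pull shift (dten 1 (pull (coswap H H) delta)).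
  apply: dual_tens3P => g h x.
  by rewrite !pullE !legE shiftE dtenE dual1E pullE coE linearZ.
have -> : pull leg2 v =
    pull shift (pull (cotens (coid H) (comul H)) (pull (coswap H H) v)).
  by apply: dual_tens3P => g h x; rewrite !pullE !legE shiftE !coE.
apply: pull_comm; apply: dten_comm => b.
have -> : pull (comul H) b = pull (coswap H H) (pull comulop b).
  by apply: dual_tensP => c d; rewrite !pullE !coE.
exact: pull_comm.
Qed.

Lemma twist_form_comm b : GRing.comm twist_form (pull total_mul b).
Proof.
(* h (g x) and (h g) x are opposite products of the second and third legs *)
have e2 : pull total_mul b = pull leg2 (pull comulop b).
  by apply: dual_tens3P => g h x; rewrite !pullE.
have e3 : pull total_mul b = pull leg3 (pull comulop b).
  by apply: dual_tens3P => g h x; rewrite !pullE !legE comulopE mulrA.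
have c1 : GRing.comm (pull total_mul b) (pull leg1 delta).
  by apply: commr_sym; rewrite e2; apply: leg1_comm.
have c2 : GRing.comm (pull total_mul b) (pull leg2 delta).
  by apply: commr_sym; rewrite e2; apply: pull_comm.
have c3 : GRing.comm (pull total_mul b) (pull leg3 delta^-1).
  rewrite e3; apply: pull_comm; apply: commrV; apply: commr_sym; exact: delta_comm.
by rewrite /twist_form; apply: commr_sym; apply: commrM => //; apply: commrM.
Qed.

(** Of the six factors on each side, four occur on both sides and the other two
    are mutually inverse.  On the left these two are separated by the factor
    a = delta(x, h), which commutes with everything to its left because h and x
    occur there only through h x. *)
Lemma twist_form_cocycle :
  pull face1 twist_form * pull face2 twist_form
    = pull face3 twist_form * pull face4 twist_form.
Proof.
rewrite !pull_twist_form.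
set a := pull face2 (pull leg1 delta); set b := pull face1 (pull leg1 delta).
set c := pull face1 (pull leg2 delta); set d := pull face1 (pull leg3 delta).
set e := pull face3 (pull leg3 delta); set z := pull face2 (pull leg3 delta).
have e22 : pull face2 (pull leg2 delta) = d.
  by apply: dual_tens4P => f g h x; rewrite !pullE !legE.
have e31 : a = pull face3 (pull leg1 delta).
  apply: dual_tens4P => f g h x; rewrite !pullE !legE comapZ legE !linearZ /=.
  by rewrite counitM mulrA.
have eb : pull face3 (pull leg2 delta) = b.
  by apply: dual_tens4P => f g h x; rewrite !pullE !legE !comapZ legE ?linearZ.
rewrite e22 -e31 eb.
have -> : pull face4 (pull leg1 delta) = e.
  by apply: dual_tens4P => f g h x; rewrite !pullE !legE !comapZ legE ?linearZ.
have -> : pull face4 (pull leg2 delta) = c.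
  by apply: dual_tens4P => f g h x; rewrite !pullE !legE mulrA.
have -> : pull face4 (pull leg3 delta) = z.
  by apply: dual_tens4P => f g h x; rewrite !pullE !legE mulrA.
(* a and b are the first two factors of one form, and so are a and d *)
have ab : GRing.comm a b.
  by rewrite -eb e31; apply/pull_comm/leg1_comm.
have ad : GRing.comm a d.
  by rewrite /a -e22; apply/pull_comm/leg1_comm.
(* c is delta(g h x, f), and a is delta(x, h) with f and g discarded *)
have ac : GRing.comm a c.
  have -> : a = pull (coassoc _ _ _) (dten 1 (pull (coswap H H) delta)).
    apply: dual_tens4P => f g h x; rewrite !pullE !legE coassocE dtenE dual1E.
    by rewrite [counit (f ⊗ g)]tensor_counitE pullE coE linearZ counitM.
  have -> : c = pull (coassoc _ _ _) (pull (cotens (coswap H H) (comul H))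
      (pull leg2 delta)).
    by apply: dual_tens4P => f g h x; rewrite !pullE /face1 cocompE.
  apply: pull_comm; apply: dten_comm => u.
  have -> : pull (comul H) u = pull (coswap H H) (pull comulop u).
    by apply: dual_tensP => x y; rewrite !pullE !coE.
  exact: pull_comm.
by apply: slide_cancel; rewrite ?pull_unit.
Qed.
End Comm.

Section Unit.
Hypothesis delta_unitr : forall h : H, delta (h ⊗ 1) = counit h.
Hypothesis delta_unitl : forall h : H, delta (1 ⊗ h) = counit h.

Lemma twist_form_unitr : pull unitr_face twist_form = 1.
Proof.
rewrite pull_twist_form.
have -> : pull unitr_face (pull leg2 delta) = 1.
  apply: dual_tensP => h x; rewrite !pullE !legE delta_unitr counitM.
  by rewrite dual1E [RHS]tensor_counitE.
have -> : pull unitr_face (pull leg3 delta) = pull unitr_face (pull leg1 delta).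
  by apply: dual_tensP => h x; rewrite !pullE !legE counit1 scale1r mul1r.
by rewrite mulr1 divrr // !pull_unit.
Qed.

Lemma twist_form_unitl : pull unitl_face twist_form = 1.
Proof.
rewrite pull_twist_form.
have -> : pull unitl_face (pull leg1 delta) = 1.
  apply: dual_tensP => h x; rewrite !pullE !legE linearZ /= delta_unitr.
  by rewrite dual1E [RHS]tensor_counitE.
have -> : pull unitl_face (pull leg3 delta) = pull unitl_face (pull leg2 delta).
  by apply: dual_tensP => h x; rewrite !pullE !legE mul1r mulr1.
by rewrite mul1r divrr // !pull_unit.
Qed.

Lemma twist_form_at_one : pull at_one twist_form = delta.
Proof.
rewrite pull_twist_form.
have -> : pull at_one (pull leg1 delta) = 1.
  apply: dual_tensP => g h; rewrite !pullE !legE linearZ /= delta_unitl.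
  by rewrite mulrC dual1E [RHS]tensor_counitE.
have -> : pull at_one (pull leg2 delta) = delta.
  by apply: dual_tensP => g h; rewrite !pullE !legE mulr1.
have -> : pull at_one (pull leg3 delta) = 1.
  apply: dual_tensP => g h; rewrite !pullE !legE delta_unitl counitM.
  by rewrite mulrC dual1E [RHS]tensor_counitE.
by rewrite invr1 mulr1 mul1r.
Qed.
End Unit.
End Twist.
End Legs.

Section CocycleForm.
Variables (k : fieldType) (H : hopfAlgType k).
Implicit Types (delta : dual (H ⊗ H)%type) (a b c : dual H).

Let pure3 a b c : dual (H ⊗ H ⊗ H)%type := dten (dten a b) c.
Let pure3E a b c g h x : pure3 a b c (g ⊗ h ⊗ x) = a g * b h * c x.
Proof. by rewrite !dtenE. Qed.
Let pure3M a b c a' b' c' :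
  pure3 a b c * pure3 a' b' c' = pure3 (a * a') (b * b') (c * c').
Proof. by rewrite !dtenM. Qed.

(** The three factors are expanded into sums of pure functionals, which
    multiply componentwise; this matches the definition of the cocycle of a
    twist term by term. *)
Lemma pull_leg1_pair delta : pull (leg1 H) delta =
  \T_(d1, d2 <- dual_pair delta) pure3 d2 1 d1.
Proof.
apply: dual_tens3P => g h x; rewrite pullE legE linearZ /= dual_tsumE.
rewrite -dual_pairE tsum_mulr; apply: eq_tsumk => d1 d2.
by rewrite pure3E dual1E mulrC [d1 x * _]mulrC mulrAC.
Qed.

Lemma pull_leg2_pair delta : pull (leg2 H) delta =
  \T_(d1, d2 <- dual_pair delta) \T_(p1, p2 <- coprod d1) pure3 p1 d2 p2.
Proof.
apply: dual_tens3P => g h x; rewrite pullE legE dual_tsumE.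
rewrite -dual_pairE; apply: eq_tsumk => d1 d2.
rewrite dual_tsumE -dual_coprodE tsum_mull; apply: eq_tsumk => p1 p2.
by rewrite pure3E mulrAC.
Qed.

Lemma pull_leg3_pair delta : pull (leg3 H) delta =
  \T_(d1, d2 <- dual_pair delta) \T_(q1, q2 <- coprod d2) pure3 q2 q1 d1.
Proof.
apply: dual_tens3P => g h x; rewrite pullE legE dual_tsumE.
rewrite -dual_pairE; apply: eq_tsumk => d1 d2.
rewrite dual_tsumE -dual_coprodE tsum_mulr; apply: eq_tsumk => q1 q2.
by rewrite pure3E mulrC [q1 h * _]mulrC.
Qed.

Lemma twist_cocycle_form delta g h x :
  twist_cocycle delta (g ⊗ h) x = twist_form delta (g ⊗ h ⊗ x).
Proof.
rewrite twist_cocycleE /twist_form pull_leg1_pair pull_leg2_pair pull_leg3_pair.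
rewrite -mulrA [in RHS](lin_tsumE _ _ (f := fun s => s * _)); last by lin_tac.
rewrite !dual_tsumE; apply: eq_tsumk => d1 d2.
rewrite [in RHS](lin_tsumE _ _ (f := fun s => _ * (s * _))); last by lin_tac.
rewrite !dual_tsumE; apply: eq_tsumk => d1' d2'.
rewrite [in RHS](lin_tsumE _ _ (f := fun s => _ * (_ * s))); last by lin_tac.
rewrite !dual_tsumE; apply: eq_tsumk => e1 e2.
rewrite [in RHS](lin_tsumE _ _ (f := fun s => _ * (s * _))); last by lin_tac.
rewrite !dual_tsumE; apply: eq_tsumk => p1 p2.
rewrite [in RHS](lin_tsumE _ _ (f := fun s => _ * (_ * s))); last by lin_tac.
rewrite !dual_tsumE; apply: eq_tsumk => q1 q2.
by rewrite dualZ !pure3M pure3E mul1r !mulrA.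
Qed.

End CocycleForm.

(** * Regrouping iterated coproducts *)

Section Regroup.
Variables (k : fieldType) (C : nzCoalgType k) (W : lmodType k).

(** Coassociativity, for coproducts iterated on the left leg: those of
    [sweedler] are iterated on the right one. *)
Lemma sweedler4_left3 (F : C -> C -> C -> C -> W) c :
  (forall y z t, lin (fun x => F x y z t)) ->
  (forall x z t, lin (fun y => F x y z t)) ->
  (forall x y t, lin (fun z => F x y z t)) ->
  (forall x y z, lin (fun t => F x y z t)) ->
  \T_(u, v <- coprod c) \Sw[3]_(c1 c2 c3 <- u) F c1 c2 c3 v
    = \Sw[4]_(c1 c2 c3 c4 <- c) F c1 c2 c3 c4.
Proof.
move=> h1 h2 h3 h4.
rewrite (coprodA_fun c (F := fun c1 u v => \T_(c2, c3 <- coprod u) F c1 c2 c3 v));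
  try by move=> *; lin_tac.
apply: eq_tsum => c1 v.
by rewrite (coprodA_fun v (F := fun c2 c3 c4 => F c1 c2 c3 c4)).
Qed.

Section Exchange.
Variables (X : lmodType k) (Y : vectType k) (t : (X ⊗ Y)%type).

Lemma tsum_sweedler3 (F : X -> Y -> C -> C -> C -> W) c :
  \T_(x, y <- t) \Sw[3]_(c1 c2 c3 <- c) F x y c1 c2 c3
    = \Sw[3]_(c1 c2 c3 <- c) \T_(x, y <- t) F x y c1 c2 c3.
Proof. by rewrite /= tsum_exchange; apply: eq_tsum => *; rewrite tsum_exchange. Qed.

Lemma tsum_sweedler4 (F : X -> Y -> C -> C -> C -> C -> W) c :
  \T_(x, y <- t) \Sw[4]_(c1 c2 c3 c4 <- c) F x y c1 c2 c3 c4
    = \Sw[4]_(c1 c2 c3 c4 <- c) \T_(x, y <- t) F x y c1 c2 c3 c4.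
Proof.
rewrite /= tsum_exchange; apply: eq_tsum => c1 r.
exact: (tsum_sweedler3 (fun x y c2 c3 c4 => F x y c1 c2 c3 c4) r).
Qed.

End Exchange.

Lemma sweedler3_exchange (F : C -> C -> C -> C -> C -> C -> W) c d :
  \Sw[3]_(c1 c2 c3 <- c) \Sw[3]_(d1 d2 d3 <- d) F c1 c2 c3 d1 d2 d3
  = \Sw[3]_(d1 d2 d3 <- d) \Sw[3]_(c1 c2 c3 <- c) F c1 c2 c3 d1 d2 d3.
Proof.
transitivity (\T_(c1, r <- coprod c) \Sw[3]_(d1 d2 d3 <- d)
  \T_(c2, c3 <- coprod r) F c1 c2 c3 d1 d2 d3); last exact: tsum_sweedler3.
by apply: eq_tsum => c1 r; apply: tsum_sweedler3.
Qed.

(** The pattern met in f1 S(f3), f2, f4 when the form of a twist splits both f4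
    and the product f1 S(f3) in three. *)
Lemma sweedler10_regroup
    (K : C -> C -> C -> C -> C -> C -> C -> C -> C -> C -> W) c :
  (forall a2 a3 b u1 u2 u3 w1 w2 w3,
     lin (fun a1 => K a1 a2 a3 b u1 u2 u3 w1 w2 w3)) ->
  (forall a1 a3 b u1 u2 u3 w1 w2 w3,
     lin (fun a2 => K a1 a2 a3 b u1 u2 u3 w1 w2 w3)) ->
  (forall a1 a2 b u1 u2 u3 w1 w2 w3,
     lin (fun a3 => K a1 a2 a3 b u1 u2 u3 w1 w2 w3)) ->
  (forall a1 a2 a3 u1 u2 u3 w1 w2 w3,
     lin (fun b => K a1 a2 a3 b u1 u2 u3 w1 w2 w3)) ->
  (forall a1 a2 a3 b u2 u3 w1 w2 w3,
     lin (fun u1 => K a1 a2 a3 b u1 u2 u3 w1 w2 w3)) ->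
  (forall a1 a2 a3 b u1 u3 w1 w2 w3,
     lin (fun u2 => K a1 a2 a3 b u1 u2 u3 w1 w2 w3)) ->
  (forall a1 a2 a3 b u1 u2 w1 w2 w3,
     lin (fun u3 => K a1 a2 a3 b u1 u2 u3 w1 w2 w3)) ->
  (forall a1 a2 a3 b u1 u2 u3 w2 w3,
     lin (fun w1 => K a1 a2 a3 b u1 u2 u3 w1 w2 w3)) ->
  \Sw[4]_(c1 c2 c3 c4 <- c) \Sw[3]_(a1 a2 a3 <- c1) \Sw[3]_(u1 u2 u3 <- c3)
    \Sw[3]_(w1 w2 w3 <- c4) K a1 a2 a3 c2 u1 u2 u3 w1 w2 w3
  = \Sw[10]_(a1 a2 a3 b u1 u2 u3 w1 w2 w3 <- c) K a1 a2 a3 b u1 u2 u3 w1 w2 w3.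
Proof.
move=> h1 h2 h3 h4 h5 h6 h7 h8.
transitivity (\T_(c1, r <- coprod c) \Sw[3]_(a1 a2 a3 <- c1)
  \T_(b, s <- coprod r) \T_(c3, c4 <- coprod s) \Sw[3]_(u1 u2 u3 <- c3)
    \Sw[3]_(w1 w2 w3 <- c4) K a1 a2 a3 b u1 u2 u3 w1 w2 w3).
  apply: eq_tsum => c1 r.
  rewrite -(tsum_sweedler3 (coprod r) (fun b s a1 a2 a3 =>
    \T_(c3, c4 <- coprod s) \Sw[3]_(u1 u2 u3 <- c3)
    \Sw[3]_(w1 w2 w3 <- c4) K a1 a2 a3 b u1 u2 u3 w1 w2 w3)).
  apply: eq_tsum => b s.
  by rewrite -(tsum_sweedler3 (coprod s) (fun c3 c4 a1 a2 a3 =>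
    \Sw[3]_(u1 u2 u3 <- c3) \Sw[3]_(w1 w2 w3 <- c4)
    K a1 a2 a3 b u1 u2 u3 w1 w2 w3)).
rewrite (sweedler4_left3 (F := fun a1 a2 a3 r =>
  \T_(b, s <- coprod r) \T_(c3, c4 <- coprod s) \Sw[3]_(u1 u2 u3 <- c3)
    \Sw[3]_(w1 w2 w3 <- c4) K a1 a2 a3 b u1 u2 u3 w1 w2 w3));
  try by move=> *; rewrite /=; lin_tac.
apply: eq_tsum => a1 r1; apply: eq_tsum => a2 r2; apply: eq_tsum => a3 r3.
apply: eq_tsum => b r4.
by rewrite (sweedler4_left3 (F := fun u1 u2 u3 r =>
    \Sw[3]_(w1 w2 w3 <- r) K a1 a2 a3 b u1 u2 u3 w1 w2 w3)) // => *;
  rewrite /=; lin_tac.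
Qed.

Lemma sweedler8_regroup (K : C -> C -> C -> C -> C -> C -> C -> C -> W) c :
  (forall a2 b u1 u2 w1 w2 w3,
     lin (fun a1 => K a1 a2 b u1 u2 w1 w2 w3)) ->
  (forall a1 b u1 u2 w1 w2 w3,
     lin (fun a2 => K a1 a2 b u1 u2 w1 w2 w3)) ->
  (forall a1 a2 u1 u2 w1 w2 w3,
     lin (fun b => K a1 a2 b u1 u2 w1 w2 w3)) ->
  (forall a1 a2 b u2 w1 w2 w3,
     lin (fun u1 => K a1 a2 b u1 u2 w1 w2 w3)) ->
  (forall a1 a2 b u1 w1 w2 w3,
     lin (fun u2 => K a1 a2 b u1 u2 w1 w2 w3)) ->
  (forall a1 a2 b u1 u2 w2 w3,
     lin (fun w1 => K a1 a2 b u1 u2 w1 w2 w3)) ->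
  \Sw[4]_(c1 c2 c3 c4 <- c) \Sw[2]_(a1 a2 <- c1) \Sw[2]_(u1 u2 <- c3)
    \Sw[3]_(w1 w2 w3 <- c4) K a1 a2 c2 u1 u2 w1 w2 w3
  = \Sw[8]_(a1 a2 b u1 u2 w1 w2 w3 <- c) K a1 a2 b u1 u2 w1 w2 w3.
Proof.
move=> h1 h2 h3 h4 h5 h6.
transitivity (\T_(c1, r <- coprod c) \T_(a1, a2 <- coprod c1)
  \T_(b, s <- coprod r) \T_(c3, c4 <- coprod s) \T_(u1, u2 <- coprod c3)
    \Sw[3]_(w1 w2 w3 <- c4) K a1 a2 b u1 u2 w1 w2 w3).
  apply: eq_tsum => c1 r; rewrite [RHS]tsum_exchange.
  apply: eq_tsum => b s; rewrite [RHS]tsum_exchange; exact: eq_tsum.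
rewrite (coprodA_fun c (F := fun a1 a2 r =>
  \T_(b, s <- coprod r) \T_(c3, c4 <- coprod s) \T_(u1, u2 <- coprod c3)
    \Sw[3]_(w1 w2 w3 <- c4) K a1 a2 b u1 u2 w1 w2 w3));
  try by move=> *; rewrite /=; lin_tac.
apply: eq_tsum => a1 r1; apply: eq_tsum => a2 r2; apply: eq_tsum => b r3.
by rewrite (coprodA_fun r3 (F := fun u1 u2 r =>
  \Sw[3]_(w1 w2 w3 <- r) K a1 a2 b u1 u2 w1 w2 w3)) // => *;
  rewrite /=; lin_tac.
Qed.

End Regroup.

(** Rules for pulling inner coproducts out of a sum: the premise is the same
    exchange for the summand, so that they chain through nested sums. *)
Section Under.
Variables (k : fieldType) (C : nzCoalgType k) (Y : vectType k).
Variables (U W : lmodType k) (t : (U ⊗ Y)%type).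

Lemma tsum_under_sweedler33 (F : U -> Y -> W)
    (G : U -> Y -> C -> C -> C -> C -> C -> C -> W) c d :
  (forall x y, F x y = \Sw[3]_(a1 a2 a3 <- c) \Sw[3]_(b1 b2 b3 <- d)
     G x y a1 a2 a3 b1 b2 b3) ->
  tsum t F = \Sw[3]_(a1 a2 a3 <- c) \Sw[3]_(b1 b2 b3 <- d)
     \T_(x, y <- t) G x y a1 a2 a3 b1 b2 b3.
Proof.
move=> FG; rewrite (eq_tsum _ FG) tsum_sweedler3.
by apply: eq_tsum => *; apply: eq_tsum => *; rewrite tsum_sweedler3.
Qed.

Lemma tsum_under_sweedler22 (F : U -> Y -> W)
    (G : U -> Y -> C -> C -> C -> C -> W) c d :
  (forall x y, F x y = \Sw[2]_(a1 a2 <- c) \Sw[2]_(b1 b2 <- d)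
     G x y a1 a2 b1 b2) ->
  tsum t F = \Sw[2]_(a1 a2 <- c) \Sw[2]_(b1 b2 <- d)
     \T_(x, y <- t) G x y a1 a2 b1 b2.
Proof.
move=> FG; rewrite (eq_tsum _ FG) tsum_exchange.
by apply: eq_tsum => *; rewrite tsum_exchange.
Qed.

Lemma tsum_under_sweedler4 (F : U -> Y -> W)
    (G : U -> Y -> C -> C -> C -> C -> W) c :
  (forall x y, F x y = \Sw[4]_(c1 c2 c3 c4 <- c) G x y c1 c2 c3 c4) ->
  tsum t F = \Sw[4]_(c1 c2 c3 c4 <- c) \T_(x, y <- t) G x y c1 c2 c3 c4.
Proof. by move=> FG; rewrite (eq_tsum _ FG) tsum_sweedler4. Qed.

End Under.

(** * The twist conditions in Sweedler form *)

Section HopfDuality.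
Variables (k : fieldType) (H : hopfAlgType k).

Lemma dual_separates (x y : H) : (forall b : dual H, b x = b y) -> x = y.
Proof.
move=> xy; rewrite [x]tbase_sum [y]tbase_sum; apply: eq_bigr => i _.
have := xy (dual_of (fun h => tcoord i h)).
by rewrite !dual_ofE; [move=> -> | lin_tac | lin_tac].
Qed.

(** Dual to the antipode of H^* being an algebra antimorphism. *)
Lemma antipode_coprod (h : H) :
  coprod (antipode h) = \T_(h1, h2 <- coprod h) antipode h2 ⊗ antipode h1.
Proof.
apply: contr_ext => b; apply: dual_separates => a.
rewrite [in RHS](lin_tsumE _ _ (contr_lin b)) {1}/contr !dual_tsum_arg.
transitivity ((a * b) (antipode h)).
  by rewrite dualME; apply: eq_tsumk => x y; rewrite linearZ mulrC.
rewrite -[LHS]dual_antipodeE -[dual_antipode _]/(antipode (a * b)) antipodeM dualME.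
apply: eq_tsumk => h1 h2.
by rewrite contr_tens linearZ /= -!dual_antipodeE.
Qed.

Lemma tsum_coprod_antipode (W : lmodType k) (F : H -> H -> W) h :
  (forall y, lin (F^~ y)) -> (forall x, lin (F x)) ->
  tsum (coprod (antipode h)) F
    = \T_(h1, h2 <- coprod h) F (antipode h2) (antipode h1).
Proof.
move=> hl hr; rewrite antipode_coprod (lin_tsumE _ _ (f := fun s => tsum s F)).
  by apply: eq_tsum => x y; rewrite tsum_tens.
by lin_tac.
Qed.

(** The coaction of H^*, made explicit: its definition by duality is the
    adjoint action, evaluated by [dual_adE]. *)
Lemma dual_coact_sum (b : dual H) (y : H) :
  \T_(b0, b1 <- dual_coact b) (b0 y *: b1)
  = \Sw[3]_(y1 y2 y3 <- y) (b y2 *: (y1 * antipode y3)).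
Proof.
apply: dual_separates => c; rewrite dual_tsum_arg.
transitivity (dual_ad c b y).
  rewrite -dual_coactE dual_tsumE; apply: eq_tsumk => b0 b1.
  by rewrite linearZ dualZ mulrC.
rewrite dual_adE dual_tsum_arg; apply: eq_tsumk => y1 y'.
rewrite dual_tsum_arg; apply: eq_tsumk => y2 y3.
by rewrite linearZ mulrC.
Qed.

End HopfDuality.

Section SweedlerHopf.
Variables (k : fieldType) (H : hopfAlgType k) (W : lmodType k).
Variable K : H -> H -> H -> W.
Hypotheses (K1 : forall y z, lin (fun x => K x y z))
  (K2 : forall x z, lin (fun y => K x y z)) (K3 : forall x y, lin (K x y)).

Lemma sweedler3_mul y z : \Sw[3]_(a1 a2 a3 <- y * z) K a1 a2 a3
  = \Sw[3]_(y1 y2 y3 <- y) \Sw[3]_(z1 z2 z3 <- z) K (y1 * z1) (y2 * z2) (y3 * z3).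
Proof.
rewrite /= coprodM_fun; try by move=> ?; lin_tac.
apply: eq_tsum => y1 y'; rewrite [RHS]tsum_exchange.
rewrite [RHS](_ : _ = \T_(z1, z' <- coprod z) \T_(y2, y3 <- coprod y')
  \T_(z2, z3 <- coprod z') K (y1 * z1) (y2 * z2) (y3 * z3)).
  by apply: eq_tsum => z1 z'; rewrite coprodM_fun // => ?; lin_tac.
by rewrite tsum_exchange.
Qed.

Lemma sweedler3_antipode z : \Sw[3]_(a1 a2 a3 <- antipode z) K a1 a2 a3
  = \Sw[3]_(z1 z2 z3 <- z) K (antipode z3) (antipode z2) (antipode z1).
Proof.
rewrite /= tsum_coprod_antipode; try by move=> ?; lin_tac.
rewrite -(coprodA_fun z (F := fun z1 z2 z3 =>
  K (antipode z3) (antipode z2) (antipode z1))); first last.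
- by move=> x y; apply: (lin_comp (K1 _ _)); lin_tac.
- by move=> x y; apply: (lin_comp (K2 _ _)); lin_tac.
- by move=> x y; apply: (lin_comp (K3 _ _)); lin_tac.
by apply: eq_tsum => z1 z2; rewrite tsum_coprod_antipode // => ?; lin_tac.
Qed.

End SweedlerHopf.

Section SweedlerForm.
Variables (k : fieldType) (H : hopfAlgType k) (delta : dual (H ⊗ H)%type).

Definition twist_term (x1 x2 x3 g1 g2 h1 h2 h3 : H) : k :=
  delta (x1 ⊗ h1) * delta ((h2 * x2) ⊗ g1) * delta^-1 (x3 ⊗ (g2 * h3)).

Lemma twist_formE h g x : twist_form delta (h ⊗ g ⊗ x) =
  \Sw[3]_(x1 x2 x3 <- x) \Sw[2]_(g1 g2 <- g) \Sw[3]_(h1 h2 h3 <- h)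
    (twist_term x1 x2 x3 g1 g2 h1 h2 h3 : k^o).
Proof.
rewrite /twist_form -mulrA dual_tens3_mulE.
(* the first factor sees g through the counit only, so one leg of g vanishes *)
transitivity (\T_(h1, h' <- coprod h) \T_(x1, x' <- coprod x)
  (delta (x1 ⊗ h1) * (pull (leg2 H) delta * pull (leg3 H) delta^-1)
     (h' ⊗ g ⊗ x') : k^o) : k).
  apply: eq_tsumk => h1 h'; rewrite tsum_exchangek; apply: eq_tsumk => x1 x'.
  rewrite -[RHS](counitl_fun (W := k^o) g (F := fun g' => delta (x1 ⊗ h1) *
    (pull (leg2 H) delta * pull (leg3 H) delta^-1) (h' ⊗ g' ⊗ x')));
    last by lin_tac.
  apply: eq_tsumk => g1 g2; rewrite pullE legE linearZ /= -mulrA; reflexivity.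
rewrite tsum_exchangek; apply: eq_tsumk => x1 x'.
transitivity (\T_(h1, h' <- coprod h)  \T_(h2, h3 <- coprod h')
 \T_(g1, g2 <- coprod g) \T_(x2, x3 <- coprod x')
   (twist_term x1 x2 x3 g1 g2 h1 h2 h3 : k^o) : k).
  apply: eq_tsumk => h1 h'; rewrite dual_tens3_mulE tsum_mulr.
  apply: eq_tsumk => h2 h3; rewrite tsum_mulr; apply: eq_tsumk => g1 g2.
  rewrite tsum_mulr; apply: eq_tsumk => x2 x3.
  by rewrite /twist_term !pullE !legE mulrA.
under [LHS]eq_tsum => h1 h' do under eq_tsum => h2 h3 do rewrite tsum_exchange.
under [LHS]eq_tsum => h1 h' do rewrite tsum_exchange.
rewrite [LHS]tsum_exchange; apply: eq_tsumk => x2 x3.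
under [LHS]eq_tsum => h1 h' do rewrite tsum_exchange.
by rewrite [LHS]tsum_exchange.
Qed.

End SweedlerForm.

Section Unfold.
Variables (k : fieldType) (H : hopfAlgType k).

(** [Z2_coact] for the form of a cocycle, see [clause_coact]. *)
Definition coact_compatible (Gam : dual (H ⊗ H ⊗ H)%type) :=
  forall f g h : H,
  \T_(f1, f2 <- coprod f) (Gam (h ⊗ g ⊗ f1) *: f2)
  = \Sw[4]_(f1 f2 f3 f4 <- f)
      (Gam ((h * (f1 * antipode f3)) ⊗ g ⊗ f4) *: f2).

(** [Z2_act_coact] for the form of a cocycle, see [clause_act_coact]. *)
Definition act_coact_compatible (Gam : dual (H ⊗ H ⊗ H)%type) :=
  forall f g h : H,
  \T_(f1, f2 <- coprod f) \T_(h1, h2 <- coprod h)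
    (Gam (h1 ⊗ g ⊗ f1) *: (h2 * f2))
  = \Sw[4]_(f1 f2 f3 f4 <- f) \Sw[4]_(h1 h2 h3 h4 <- h)
      (Gam (h4 ⊗ (g * (h1 * f1 * antipode (h3 * f3))) ⊗ f4) *: (h2 * f2)).

Variable delta : dual (H ⊗ H)%type.

Lemma twist_formZ h g x (y : H) : twist_form delta (h ⊗ g ⊗ x) *: y =
  \Sw[3]_(x1 x2 x3 <- x) \Sw[2]_(g1 g2 <- g) \Sw[3]_(h1 h2 h3 <- h)
    (twist_term delta x1 x2 x3 g1 g2 h1 h2 h3 *: y).
Proof.
rewrite twist_formE /=; do 5! (rewrite [LHS]tsum_scalel; apply: eq_tsum => ? ?).
reflexivity.
Qed.

Lemma twist_coact_lhs f g h :
  \T_(f1, f2 <- coprod f) (twist_form delta (h ⊗ g ⊗ f1) *: f2)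
  = \Sw[4]_(f1 f2 f3 f4 <- f) \Sw[2]_(g1 g2 <- g) \Sw[3]_(h1 h2 h3 <- h)
      ((delta (f1 ⊗ h1) * delta ((h2 * f2) ⊗ g1)
        * delta^-1 (f3 ⊗ (g2 * h3))) *: f4).
Proof.
rewrite -(sweedler4_left3 (F := fun f1 f2 f3 f4 => \Sw[2]_(g1 g2 <- g)
  \Sw[3]_(h1 h2 h3 <- h) (twist_term delta f1 f2 f3 g1 g2 h1 h2 h3 *: f4)));
  try by move=> *; rewrite /= /twist_term; lin_tac.
by apply: eq_tsum => f1 f2; rewrite twist_formZ.
Qed.

(** The form takes the coproducts of h f1 S(f3) and of f4 in three legs.  The
    antipode reverses the legs of f3, and those of f4 come last: hence ten legs,
    with f5, f6, f7 in decreasing order. *)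
Lemma twist_coact_rhs f g h :
  \Sw[4]_(f1 f2 f3 f4 <- f)
      (twist_form delta ((h * (f1 * antipode f3)) ⊗ g ⊗ f4) *: f2)
  = \Sw[10]_(f1 f2 f3 f4 f5 f6 f7 f8 f9 f10 <- f) \Sw[2]_(g1 g2 <- g)
      \Sw[3]_(h1 h2 h3 <- h)
      ((delta (f8 ⊗ (h1 * f1 * antipode f7))
        * delta ((h2 * f2 * antipode f6 * f9) ⊗ g1)
        * delta^-1 (f10 ⊗ (g2 * h3 * f3 * antipode f5))) *: f4).
Proof.
pose K (f1 f2 f3 f4 f5 f6 f7 f8 f9 f10 : H) : H := \Sw[2]_(g1 g2 <- g)
      \Sw[3]_(h1 h2 h3 <- h)
      ((delta (f8 ⊗ (h1 * f1 * antipode f7))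
        * delta ((h2 * f2 * antipode f6 * f9) ⊗ g1)
        * delta^-1 (f10 ⊗ (g2 * h3 * f3 * antipode f5))) *: f4).
rewrite -[RHS](sweedler10_regroup (K := K));
  try by move=> *; rewrite /K /=; lin_tac.
apply: eq_tsum => f1 r1; apply: eq_tsum => f2 r2; apply: eq_tsum => f3 f4.
rewrite twist_formZ.
apply: tsum_under_sweedler33 => w1 w'; apply: tsum_under_sweedler33 => w2 w3.
apply: tsum_under_sweedler33 => g1 g2.
pose T a1 a2 a3 : H := twist_term delta w1 w2 w3 g1 g2 a1 a2 a3 *: f2.
have T1 y z : lin (fun x => T x y z) by rewrite /T /twist_term; lin_tac.
have T2 x z : lin (fun y => T x y z) by rewrite /T /twist_term; lin_tac.
have T3 x y : lin (T x y) by rewrite /T /twist_term; lin_tac.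
rewrite (sweedler3_mul T1 T2 T3).
apply: tsum_under_sweedler33 => h1 h'; apply: tsum_under_sweedler33 => h2 h3.
pose T' a1 a2 a3 : H := T (h1 * a1) (h2 * a2) (h3 * a3).
have T1' y z : lin (fun x => T' x y z).
  by rewrite /T'; apply: lin_comp (T1 _ _) _; lin_tac.
have T2' x z : lin (fun y => T' x y z).
  by rewrite /T'; apply: lin_comp (T2 _ _) _; lin_tac.
have T3' x y : lin (T' x y).
  by rewrite /T'; apply: lin_comp (T3 _ _) _; lin_tac.
rewrite (sweedler3_mul T1' T2' T3').
apply: eq_tsum => a1 a'; apply: eq_tsum => a2 a3.
pose T'' u1 u2 u3 : H := T' (a1 * u1) (a2 * u2) (a3 * u3).
rewrite (sweedler3_antipode (K := T'')); first last.
- by move=> x y; rewrite /T''; apply: lin_comp (T3' _ _) _; lin_tac.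
- by move=> x y; rewrite /T''; apply: lin_comp (T2' _ _) _; lin_tac.
- by move=> x y; rewrite /T''; apply: lin_comp (T1' _ _) _; lin_tac.
apply: eq_tsum => u1 u'; apply: eq_tsum => u2 u3.
by rewrite /T'' /T' /T /twist_term !mulrA.
Qed.

Lemma twist_act_coact_lhs f g h :
  \T_(f1, f2 <- coprod f) \T_(h1, h2 <- coprod h)
    (twist_form delta (h1 ⊗ g ⊗ f1) *: (h2 * f2))
  = \Sw[4]_(f1 f2 f3 f4 <- f) \Sw[2]_(g1 g2 <- g) \Sw[4]_(h1 h2 h3 h4 <- h)
      ((delta (f1 ⊗ h1) * delta ((h2 * f2) ⊗ g1)
        * delta^-1 (f3 ⊗ (g2 * h3))) *: (h4 * f4)).
Proof.
rewrite -(sweedler4_left3 (F := fun f1 f2 f3 f4 => \Sw[2]_(g1 g2 <- g)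
  \Sw[4]_(h1 h2 h3 h4 <- h)
    (twist_term delta f1 f2 f3 g1 g2 h1 h2 h3 *: (h4 * f4))));
  try by move=> *; rewrite /= /twist_term; lin_tac.
apply: eq_tsum => f1 f2.
transitivity (\T_(h1, h2 <- coprod h) \Sw[3]_(x1 x2 x3 <- f1)
  \Sw[2]_(g1 g2 <- g) \Sw[3]_(a1 a2 a3 <- h1)
    (twist_term delta x1 x2 x3 g1 g2 a1 a2 a3 *: (h2 * f2))).
  by apply: eq_tsum => h1 h2; rewrite twist_formZ.
rewrite tsum_sweedler3; apply: eq_tsum => x1 x'; apply: eq_tsum => x2 x3.
rewrite /= tsum_exchange; apply: eq_tsum => g1 g2.
by apply: (sweedler4_left3 (F := fun h1 h2 h3 h4 =>
  twist_term delta x1 x2 x3 g1 g2 h1 h2 h3 *: (h4 * f2)));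
  move=> *; rewrite /twist_term; lin_tac.
Qed.

(** As in [twist_coact_rhs], but the modified argument h1 f1 S(h3 f3) is now the
    second one, of which the form takes only two legs, and h4 and f4 are split
    in three: hence eight legs for both f and h. *)
Lemma twist_act_coact_rhs f g h :
  \Sw[4]_(f1 f2 f3 f4 <- f) \Sw[4]_(h1 h2 h3 h4 <- h)
      (twist_form delta (h4 ⊗ (g * (h1 * f1 * antipode (h3 * f3))) ⊗ f4)
        *: (h2 * f2))
  = \Sw[8]_(f1 f2 f3 f4 f5 f6 f7 f8 <- f) \Sw[2]_(g1 g2 <- g)
      \Sw[8]_(h1 h2 h3 h4 h5 h6 h7 h8 <- h)
      ((delta (f6 ⊗ h6)
        * delta ((h7 * f7) ⊗ (g1 * h1 * f1 * antipode f5 * antipode h5))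
        * delta^-1 (f8 ⊗ (g2 * h2 * f2 * antipode f4 * antipode h4 * h8)))
       *: (h3 * f3)).
Proof.
pose E (f1 f2 f3 f4 f5 f6 f7 f8 g1 g2 h1 h2 h3 h4 h5 h6 h7 h8 : H) : H :=
  (delta (f6 ⊗ h6)
    * delta ((h7 * f7) ⊗ (g1 * h1 * f1 * antipode f5 * antipode h5))
    * delta^-1 (f8 ⊗ (g2 * h2 * f2 * antipode f4 * antipode h4 * h8)))
    *: (h3 * f3).
pose K f1 f2 f3 f4 f5 f6 f7 f8 := \Sw[2]_(g1 g2 <- g)
  \Sw[8]_(h1 h2 h3 h4 h5 h6 h7 h8 <- h)
  E f1 f2 f3 f4 f5 f6 f7 f8 g1 g2 h1 h2 h3 h4 h5 h6 h7 h8.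
rewrite -[RHS](sweedler8_regroup (K := K));
  try by move=> *; rewrite /K /E /=; lin_tac.
apply: eq_tsum => f1 r1; apply: eq_tsum => f2 r2; apply: eq_tsum => f3 f4.
(* legs 1 to 4 of f give q, f2, s, w, and those of h give p, h2, r, t *)
transitivity (\T_(q1, q2 <- coprod f1) \T_(s1, s2 <- coprod f3)
  \Sw[3]_(w1 w2 w3 <- f4) \Sw[2]_(g1 g2 <- g) \Sw[4]_(h1 h2 h3 h4 <- h)
  \Sw[2]_(p1 p2 <- h1) \Sw[2]_(r1 r2 <- h3) \Sw[3]_(t1 t2 t3 <- h4)
    E q1 q2 f2 s1 s2 w1 w2 w3 g1 g2 p1 p2 h2 r1 r2 t1 t2 t3); last first.
  apply: eq_tsum => q1 q2; apply: eq_tsum => s1 s2.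
  apply: eq_tsum => w1 w'; apply: eq_tsum => w2 w3; apply: eq_tsum => g1 g2.
  by apply: (sweedler8_regroup (K := fun h1 h2 h3 h4 h5 h6 h7 h8 =>
    E q1 q2 f2 s1 s2 w1 w2 w3 g1 g2 h1 h2 h3 h4 h5 h6 h7 h8)) => *;
    rewrite /E; lin_tac.
transitivity (\Sw[4]_(h1 h2 h3 h4 <- h) \Sw[2]_(q1 q2 <- f1) \Sw[2]_(s1 s2 <- f3)
  \Sw[3]_(w1 w2 w3 <- f4) \Sw[2]_(g1 g2 <- g)
  \Sw[2]_(p1 p2 <- h1) \Sw[2]_(r1 r2 <- h3) \Sw[3]_(t1 t2 t3 <- h4)
    E q1 q2 f2 s1 s2 w1 w2 w3 g1 g2 p1 p2 h2 r1 r2 t1 t2 t3); last first.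
  by symmetry; do 5! apply: tsum_under_sweedler4 => ? ?.
apply: eq_tsum => h1 l1; apply: eq_tsum => h2 l2; apply: eq_tsum => h3 h4.
rewrite twist_formZ.
apply: tsum_under_sweedler22 => w1 w'; apply: tsum_under_sweedler22 => w2 w3.
pose T G1 G2 : H := \Sw[3]_(t1 t2 t3 <- h4)
  (twist_term delta w1 w2 w3 G1 G2 t1 t2 t3 *: (h2 * f2)).
have T1 y : lin (T^~ y) by rewrite /T /twist_term /=; lin_tac.
have T2 x : lin (T x) by rewrite /T /twist_term /=; lin_tac.
rewrite [LHS](coprodM_fun g _ T1 T2); apply: tsum_under_sweedler22 => g1 g2.
have T1' y : lin (fun u => T (g1 * u) y) by apply: lin_comp (T1 _) _; lin_tac.
have T2' x : lin (fun v => T x (g2 * v)) by apply: lin_comp (T2 _) _; lin_tac.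
rewrite coprodM_fun //.
pose T3 p1 p2 a1 a2 := T (g1 * (p1 * a1)) (g2 * (p2 * a2)).
have T3l p1 p2 y : lin (fun a => T3 p1 p2 a y).
  by rewrite /T3; apply: lin_comp (T1' _) _; lin_tac.
have T3r p1 p2 x : lin (fun a => T3 p1 p2 x a).
  by rewrite /T3; apply: lin_comp (T2' _) _; lin_tac.
have T3p p2 x y : lin (fun p => T3 p p2 x y).
  by rewrite /T3; apply: lin_comp (T1' _) _; lin_tac.
have T3q p1 x y : lin (fun p => T3 p1 p x y).
  by rewrite /T3; apply: lin_comp (T2' _) _; lin_tac.
rewrite coprodM_fun; try by move=> ?; lin_tac.
rewrite [LHS]tsum_exchange; apply: eq_tsum => q1 q2.
rewrite [RHS]tsum_exchange; apply: eq_tsum => p1 p2.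
rewrite (tsum_coprod_antipode (F := T3 (p1 * q1) (p2 * q2))) //.
rewrite coprodM_fun; first last.
- by move=> x; apply: lin_comp (T3l _ _ _) _; lin_tac.
- by move=> x; apply: lin_comp (T3r _ _ _) _; lin_tac.
rewrite tsum_exchange; apply: eq_tsum => s1 s2; apply: eq_tsum => z1 z2.
rewrite /T3 /T; apply: eq_tsum => t1 t'; apply: eq_tsum => t2 t3.
by rewrite /E /twist_term !antipodeM !mulrA.
Qed.

End Unfold.

(** * Cocycles and twist data *)

Section Correspondence.
Variables (k : fieldType) (H : hopfAlgType k).

(** The clauses of [Z2] for a form; the quantifier over the coefficient algebra
    H^* survives only in [form_act], where it amounts to a commutation. *)
Record cocycle_form (Gam : dual (H ⊗ H ⊗ H)%type) : Prop := {
  form_unit : Gam \is a GRing.unit;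
  form_unitr : pull (unitr_face H) Gam = 1;
  form_unitl : pull (unitl_face H) Gam = 1;
  form_cocycle : pull (face1 H) Gam * pull (face2 H) Gam
    = pull (face3 H) Gam * pull (face4 H) Gam;
  form_act : forall b, GRing.comm Gam (pull (total_mul H) b);
  form_act_coact : act_coact_compatible Gam;
  form_coact : coact_compatible Gam }.

Section Clauses.
Variables (c : {linear (H ⊗ H)%type -> dual H}) (Gam : dual (H ⊗ H ⊗ H)%type).
Hypothesis cE : forall h g x, c (h ⊗ g) x = Gam (h ⊗ g ⊗ x).

Lemma uncurry_form : uncurry c = Gam.
Proof. by apply: dual_tens3P => h g x; rewrite uncurryE //; apply: linE. Qed.

Lemma clause_unitr : (forall h, c (h ⊗ 1) = counit h *: 1) <->
  pull (unitr_face H) Gam = 1.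
Proof.
split=> [u|u h].
  apply: dual_tensP => h x; rewrite pullE legE -cE u dualZ !dual1E.
  by rewrite [RHS]tensor_counitE.
apply: dualP => x; rewrite cE -unitr_faceE -pullE u dualZ !dual1E.
exact: tensor_counitE.
Qed.

Lemma clause_unitl : (forall h, c (1 ⊗ h) = counit h *: 1) <->
  pull (unitl_face H) Gam = 1.
Proof.
split=> [u|u h].
  apply: dual_tensP => h x; rewrite pullE legE -cE u dualZ !dual1E.
  by rewrite [RHS]tensor_counitE.
apply: dualP => x; rewrite cE -unitl_faceE -pullE u dualZ !dual1E.
exact: tensor_counitE.
Qed.

Lemma clause_cocycle :
  (forall f g h : H,
    \Sw[2]_(f1 f2 <- f) \Sw[2]_(g1 g2 <- g) \Sw[2]_(h1 h2 <- h)
      (dual_act (c (g1 ⊗ f1)) h1 * c (h2 ⊗ (f2 * g2)))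
    = \Sw[2]_(g1 g2 <- g) \Sw[2]_(h1 h2 <- h)
      (c (h1 ⊗ g1) * c ((g2 * h2) ⊗ f))) <->
  pull (face1 H) Gam * pull (face2 H) Gam
    = pull (face3 H) Gam * pull (face4 H) Gam.
Proof.
have lhsE f g h x : (\Sw[2]_(f1 f2 <- f) \Sw[2]_(g1 g2 <- g) \Sw[2]_(h1 h2 <- h)
      (dual_act (c (g1 ⊗ f1)) h1 * c (h2 ⊗ (f2 * g2)))) x
    = (pull (face1 H) Gam * pull (face2 H) Gam) (f ⊗ g ⊗ h ⊗ x).
  rewrite dual_tens4_mulE /= dual_tsumE; apply: eq_tsumk => f1 f2.
  rewrite dual_tsumE; apply: eq_tsumk => g1 g2.
  rewrite dual_tsumE; apply: eq_tsumk => h1 h2; rewrite dualME.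
  by apply: eq_tsumk => x1 x2; rewrite dual_actE !cE !pullE !legE.
have rhsE f g h x : (\Sw[2]_(g1 g2 <- g) \Sw[2]_(h1 h2 <- h)
      (c (h1 ⊗ g1) * c ((g2 * h2) ⊗ f))) x
    = (pull (face3 H) Gam * pull (face4 H) Gam) (f ⊗ g ⊗ h ⊗ x).
  rewrite dual_tens4_mulE /= dual_tsumE.
  rewrite tsum_exchangek; apply: eq_tsumk => g1 g2.
  rewrite dual_tsumE tsum_exchangek; apply: eq_tsumk => h1 h2.
  rewrite dualME tsum_exchangek; apply: eq_tsumk => x1 x2.
  rewrite !cE -[LHS](counitl_fun (W := k^o) f (F := fun f' =>
    Gam (h1 ⊗ g1 ⊗ x1) * Gam ((g2 * h2) ⊗ f' ⊗ x2))); last by lin_tac.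
  apply: eq_tsumk => f1 f2; rewrite !pullE !legE [Gam (_ *: _)]linearZ; exact: mulrA.
split=> [E|E f g h].
  by apply: dual_tens4P => f g h x; rewrite -lhsE -rhsE E.
by apply: dualP => x; rewrite lhsE rhsE E.
Qed.

Lemma clause_act :
  (forall (g h : H) (b : dual H),
    \Sw[2]_(g1 g2 <- g) \Sw[2]_(h1 h2 <- h)
      (c (h1 ⊗ g1) * dual_act b (g2 * h2))
    = \Sw[2]_(g1 g2 <- g) \Sw[2]_(h1 h2 <- h)
      (dual_act b (g1 * h1) * c (h2 ⊗ g2))) <->
  (forall b, GRing.comm Gam (pull (total_mul H) b)).
Proof.
have lhsE g h b x : (\Sw[2]_(g1 g2 <- g) \Sw[2]_(h1 h2 <- h)
      (c (h1 ⊗ g1) * dual_act b (g2 * h2))) x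
    = (Gam * pull (total_mul H) b) (h ⊗ g ⊗ x).
  rewrite dual_tens3_mulE /= dual_tsumE tsum_exchangek; apply: eq_tsumk => g1 g2.
  rewrite dual_tsumE; apply: eq_tsumk => h1 h2; rewrite dualME.
  by apply: eq_tsumk => x1 x2; rewrite dual_actE !cE !pullE !legE mulrA.
have rhsE g h b x : (\Sw[2]_(g1 g2 <- g) \Sw[2]_(h1 h2 <- h)
      (dual_act b (g1 * h1) * c (h2 ⊗ g2))) x
    = (pull (total_mul H) b * Gam) (h ⊗ g ⊗ x).
  rewrite dual_tens3_mulE /= dual_tsumE tsum_exchangek; apply: eq_tsumk => g1 g2.
  rewrite dual_tsumE; apply: eq_tsumk => h1 h2; rewrite dualME.
  by apply: eq_tsumk => x1 x2; rewrite dual_actE !cE !pullE !legE mulrA.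
split=> [E b|E g h b].
  by apply: dual_tens3P => h g x; rewrite -lhsE -rhsE E.
by apply: dualP => x; rewrite lhsE rhsE E.
Qed.

(** Both sides are <b, _> of the two sides of [coact_compatible], after the
    coaction has been eliminated by [dual_coact_sum]. *)
Lemma clause_coact :
  (forall (g h : H) (b : dual H),
    \T_(b0, b1 <- dual_coact b) (b0 * c ((h * b1) ⊗ g)) = c (h ⊗ g) * b) <->
  coact_compatible Gam.
Proof.
have lhsE g h b x : (\T_(b0, b1 <- dual_coact b) (b0 * c ((h * b1) ⊗ g))) x
    = b (\Sw[4]_(x1 x2 x3 x4 <- x)
      (Gam ((h * (x1 * antipode x3)) ⊗ g ⊗ x4) *: x2)).
  rewrite -(sweedler4_left3 (F := fun x1 x2 x3 x4 =>
    Gam ((h * (x1 * antipode x3)) ⊗ g ⊗ x4) *: x2));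
    try by move=> *; lin_tac.
  rewrite dual_tsum_arg dual_tsumE.
  transitivity (\T_(x', x4 <- coprod x) \T_(b0, b1 <- dual_coact b)
    (Gam ((h * (b0 x' *: b1)) ⊗ g ⊗ x4) : k^o) : k).
    rewrite tsum_exchangek; apply: eq_tsumk => b0 b1; rewrite dualME.
    apply: eq_tsumk => x' x4.
    by rewrite cE -scalerAr !tensZl linearZ.
  apply: eq_tsumk => x' x4.
  rewrite -(lin_tsumE (fun (b0 : dual H) (b1 : H) => b0 x' *: b1) _
    (f := fun u => Gam ((h * u) ⊗ g ⊗ x4) : k^o)); last by lin_tac.
  rewrite dual_coact_sum /= (lin_tsumE _ _
    (f := fun u => Gam ((h * u) ⊗ g ⊗ x4) : k^o)); last by lin_tac.
  rewrite dual_tsum_arg; apply: eq_tsumk => x1 x''.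
  rewrite (lin_tsumE _ _
    (f := fun u => Gam ((h * u) ⊗ g ⊗ x4) : k^o)); last by lin_tac.
  rewrite dual_tsum_arg; apply: eq_tsumk => x2 x3.
  by rewrite -scalerAr !tensZl !linearZ /= mulrC.
have rhsE g h b x : (c (h ⊗ g) * b) x
    = b (\T_(x1, x2 <- coprod x) (Gam (h ⊗ g ⊗ x1) *: x2)).
  rewrite dualME dual_tsum_arg; apply: eq_tsumk => x1 x2.
  by rewrite cE linearZ.
split=> [E f g h|E g h b].
  by apply: dual_separates => b; rewrite -lhsE -rhsE E.
by apply: dualP => x; rewrite lhsE rhsE E.
Qed.

Lemma clause_act_coact :
  (forall (g h : H) (b : dual H),
    \Sw[2]_(h1 h2 <- h) (c (h1 ⊗ g) * dual_act b h2)
    = \Sw[2]_(h1 h2 <- h) \T_(b0, b1 <- dual_coact b)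
      (dual_act b0 h1 * c (h2 ⊗ (g * b1)))) <->
  act_coact_compatible Gam.
Proof.
have lhsE g h b x : (\Sw[2]_(h1 h2 <- h) (c (h1 ⊗ g) * dual_act b h2)) x
    = b (\T_(x1, x2 <- coprod x) \T_(h1, h2 <- coprod h)
       (Gam (h1 ⊗ g ⊗ x1) *: (h2 * x2))).
  rewrite tsum_exchange dual_tsum_arg /= dual_tsumE; apply: eq_tsumk => h1 h2.
  rewrite dualME dual_tsum_arg; apply: eq_tsumk => x1 x2.
  by rewrite cE dual_actE linearZ.
have rhsE g h b x : (\Sw[2]_(h1 h2 <- h) \T_(b0, b1 <- dual_coact b)
      (dual_act b0 h1 * c (h2 ⊗ (g * b1)))) x
    = b (\Sw[4]_(x1 x2 x3 x4 <- x) \Sw[4]_(h1 h2 h3 h4 <- h)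
      (Gam (h4 ⊗ (g * (h1 * x1 * antipode (h3 * x3))) ⊗ x4) *: (h2 * x2))).
  pose L x4 h4 u : k^o := Gam (h4 ⊗ (g * u) ⊗ x4).
  have hL x4 h4 : lin (L x4 h4) by rewrite /L; lin_tac.
  transitivity (\T_(x', x4 <- coprod x) \T_(h', h4 <- coprod h)
    L x4 h4 (\Sw[3]_(y1 y2 y3 <- h' * x') (b y2 *: (y1 * antipode y3))) : k).
    rewrite tsum_exchangek /= dual_tsumE; apply: eq_tsumk => h' h4.
    transitivity (\T_(x', x4 <- coprod x) \T_(b0, b1 <- dual_coact b)
      L x4 h4 (b0 (h' * x') *: b1) : k).
      rewrite dual_tsumE tsum_exchangek; apply: eq_tsumk => b0 b1; rewrite dualME.
      apply: eq_tsumk => x' x4.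
      by rewrite cE dual_actE (linZ (hL _ _)).
    apply: eq_tsumk => x' x4.
    rewrite -(lin_tsumE (fun (b0 : dual H) (b1 : H) => b0 (h' * x') *: b1) _
      (hL _ _)).
    exact: (congr1 (L x4 h4) (dual_coact_sum _ _)).
  rewrite -(sweedler4_left3 (F := fun x1 x2 x3 x4 => \Sw[4]_(h1 h2 h3 h4 <- h)
    (Gam (h4 ⊗ (g * (h1 * x1 * antipode (h3 * x3))) ⊗ x4) *: (h2 * x2))));
    try by move=> *; rewrite /=; lin_tac.
  rewrite dual_tsum_arg; apply: eq_tsumk => x' x4.
  pose E x4 h4 x1 x2 x3 h1 h2 h3 : H :=
    Gam (h4 ⊗ (g * (h1 * x1 * antipode (h3 * x3))) ⊗ x4) *: (h2 * x2).
  rewrite -[in RHS]/(\Sw[3]_(x1 x2 x3 <- x') \Sw[4]_(h1 h2 h3 h4 <- h)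
    E x4 h4 x1 x2 x3 h1 h2 h3).
  have -> : \Sw[3]_(x1 x2 x3 <- x') \Sw[4]_(h1 h2 h3 h4 <- h)
      E x4 h4 x1 x2 x3 h1 h2 h3 = \T_(h', h4 <- coprod h)
    \Sw[3]_(h1 h2 h3 <- h') \Sw[3]_(x1 x2 x3 <- x') E x4 h4 x1 x2 x3 h1 h2 h3.
    transitivity (\T_(h', h4 <- coprod h) \Sw[3]_(x1 x2 x3 <- x')
        \Sw[3]_(h1 h2 h3 <- h') E x4 h4 x1 x2 x3 h1 h2 h3).
      rewrite tsum_sweedler3; apply: eq_tsum => x1 x''; apply: eq_tsum => x2 x3.
      by rewrite (sweedler4_left3 (F := fun h1 h2 h3 h4 =>
        E x4 h4 x1 x2 x3 h1 h2 h3)) // => *; rewrite /E; lin_tac.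
    by apply: eq_tsum => h' h4; apply: sweedler3_exchange.
  rewrite dual_tsum_arg; apply: eq_tsumk => h' h4.
  rewrite (sweedler3_mul (K := fun y1 y2 y3 => b y2 *: (y1 * antipode y3)));
    try by move=> *; lin_tac.
  rewrite (lin_tsumE _ _ (hL _ _)) dual_tsum_arg; apply: eq_tsumk => h1 h''.
  rewrite (lin_tsumE _ _ (hL _ _)) dual_tsum_arg; apply: eq_tsumk => h2 h3.
  rewrite (lin_tsumE _ _ (hL _ _)) dual_tsum_arg; apply: eq_tsumk => x1 x''.
  rewrite (lin_tsumE _ _ (hL _ _)) dual_tsum_arg; apply: eq_tsumk => x2 x3.
  by rewrite (linZ (hL _ _)) /E linearZ /= mulrC.
split=> [E f g h|E g h b].
  by apply: dual_separates => b; rewrite -lhsE -rhsE E.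
by apply: dualP => x; rewrite lhsE rhsE E.
Qed.

End Clauses.

Lemma Z2_cocycle_form (gamma : {linear (H ⊗ H)%type -> dual_bcAlg H})
    (Gam : dual (H ⊗ H ⊗ H)%type) :
  (forall h g x, (gamma (h ⊗ g) : dual H) x = Gam (h ⊗ g ⊗ x)) ->
  Z2 gamma <-> cocycle_form Gam.
Proof.
move=> gE; pose c : {linear (H ⊗ H)%type -> dual H} := gamma.
have cE h g x : c (h ⊗ g) x = Gam (h ⊗ g ⊗ x) by exact: gE.
have inv : conv_invertible c <-> Gam \is a GRing.unit.
  by rewrite -(uncurry_form cE); apply: conv_invertible_uncurry.
split=> -[zi zr zl zc za zac zca]; split.
- exact/inv.
- exact/(clause_unitr cE).
- exact/(clause_unitl cE).
- exact/(clause_cocycle cE).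
- exact/(clause_act cE).
- exact/(clause_act_coact cE).
- exact/(clause_coact cE).
- exact/inv.
- exact/(clause_unitr cE).
- exact/(clause_unitl cE).
- exact/(clause_cocycle cE).
- exact/(clause_act cE).
- exact/(clause_act_coact cE).
- exact/(clause_coact cE).
Qed.

Lemma twist_act_comm (delta : dual (H ⊗ H)%type) :
  (forall g h : H,
    \Sw[2]_(g1 g2 <- g) \Sw[2]_(h1 h2 <- h) (delta (h1 ⊗ g1) *: (g2 * h2))
    = \Sw[2]_(g1 g2 <- g) \Sw[2]_(h1 h2 <- h) (delta (h2 ⊗ g2) *: (g1 * h1))) <->
  (forall b, GRing.comm delta (pull (comulop H) b)).
Proof.
have lhsE g h (b : dual H) : b (\Sw[2]_(g1 g2 <- g) \Sw[2]_(h1 h2 <- h)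
    (delta (h1 ⊗ g1) *: (g2 * h2))) = (delta * pull (comulop H) b) (h ⊗ g).
  rewrite dual_tens_mulE tsum_exchangek dual_tsum_arg; apply: eq_tsumk => g1 g2.
  rewrite dual_tsum_arg; apply: eq_tsumk => h1 h2.
  by rewrite linearZ pullE comulopE.
have rhsE g h (b : dual H) : b (\Sw[2]_(g1 g2 <- g) \Sw[2]_(h1 h2 <- h)
    (delta (h2 ⊗ g2) *: (g1 * h1))) = (pull (comulop H) b * delta) (h ⊗ g).
  rewrite dual_tens_mulE tsum_exchangek dual_tsum_arg; apply: eq_tsumk => g1 g2.
  rewrite dual_tsum_arg; apply: eq_tsumk => h1 h2.
  by rewrite linearZ pullE comulopE mulrC.
split=> [E b|E g h].
  by apply: dual_tensP => h g; rewrite -lhsE -rhsE E.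
by apply: dual_separates => b; rewrite lhsE rhsE E.
Qed.

Lemma twist_act_coact_form (delta : dual (H ⊗ H)%type) :
  (forall f g h : H,
    \Sw[4]_(f1 f2 f3 f4 <- f) \Sw[2]_(g1 g2 <- g) \Sw[4]_(h1 h2 h3 h4 <- h)
      ((delta (f1 ⊗ h1) * delta ((h2 * f2) ⊗ g1)
        * delta^-1 (f3 ⊗ (g2 * h3))) *: (h4 * f4))
    = \Sw[8]_(f1 f2 f3 f4 f5 f6 f7 f8 <- f) \Sw[2]_(g1 g2 <- g)
      \Sw[8]_(h1 h2 h3 h4 h5 h6 h7 h8 <- h)
      ((delta (f6 ⊗ h6)
        * delta ((h7 * f7) ⊗ (g1 * h1 * f1 * antipode f5 * antipode h5))
        * delta^-1 (f8 ⊗ (g2 * h2 * f2 * antipode f4 * antipode h4 * h8)))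
       *: (h3 * f3))) <->
  act_coact_compatible (twist_form delta).
Proof.
split=> E f g h.
  by rewrite twist_act_coact_lhs twist_act_coact_rhs E.
by rewrite -twist_act_coact_lhs -twist_act_coact_rhs E.
Qed.

Lemma twist_coact_form (delta : dual (H ⊗ H)%type) :
  (forall f g h : H,
    \Sw[4]_(f1 f2 f3 f4 <- f) \Sw[2]_(g1 g2 <- g) \Sw[3]_(h1 h2 h3 <- h)
      ((delta (f1 ⊗ h1) * delta ((h2 * f2) ⊗ g1)
        * delta^-1 (f3 ⊗ (g2 * h3))) *: f4)
    = \Sw[10]_(f1 f2 f3 f4 f5 f6 f7 f8 f9 f10 <- f) \Sw[2]_(g1 g2 <- g)
      \Sw[3]_(h1 h2 h3 <- h)
      ((delta (f8 ⊗ (h1 * f1 * antipode f7))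
        * delta ((h2 * f2 * antipode f6 * f9) ⊗ g1)
        * delta^-1 (f10 ⊗ (g2 * h3 * f3 * antipode f5))) *: f4)) <->
  coact_compatible (twist_form delta).
Proof.
split=> E f g h.
  by rewrite twist_coact_lhs twist_coact_rhs E.
by rewrite -twist_coact_lhs -twist_coact_rhs E.
Qed.

Lemma twist_datum_cocycle_form (delta : dual (H ⊗ H)%type) :
  twist_datum delta -> cocycle_form (twist_form delta).
Proof.
case=> du dr dl /twist_act_comm da dac dca; split.
- exact: twist_form_unit.
- exact: twist_form_unitr.
- exact: twist_form_unitl.
- exact: twist_form_cocycle.
- exact: twist_form_comm.
- exact/twist_act_coact_form.
- exact/twist_coact_form.
Qed.

Section AtOne.
Variable Gam : dual (H ⊗ H ⊗ H)%type.
Hypothesis Gam_form : cocycle_form Gam.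
Let delta := pull (at_one H) Gam.

(** The cocycle identity at x = 1.  It has one variable less, and f, g, h are
    then renamed h, g, x by q; Gam, which occurs once with its third argument
    free, can be isolated. *)
Lemma cocycle_form_twist : Gam = twist_form delta.
Proof.
case: Gam_form => Gu _ _ Gc _ _ _.
have du : delta \is a GRing.unit by rewrite pull_unit.
pose q : comap (H ⊗ H ⊗ H)%type (H ⊗ H ⊗ H ⊗ H)%type :=
  cocomp (coins1 H _) (cotens (coswap H H) (coid H)).
have qE g h x : q (g ⊗ h ⊗ x) = h ⊗ g ⊗ x ⊗ 1.
  by rewrite cocompE cotensE coswapE.
have := congr1 (pull q) Gc; rewrite !pullM.
have -> : pull q (pull (face1 H) Gam) = Gam.
  by apply: dual_tens3P => g h x; rewrite !pullE qE legE mulr1.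
have -> : pull q (pull (face2 H) Gam) = pull (leg3 H) delta.
  by apply: dual_tens3P => g h x; rewrite !pullE qE !legE.
have -> : pull q (pull (face3 H) Gam) = pull (leg1 H) delta.
  by apply: dual_tens3P => g h x; rewrite !pullE qE !legE tensZl.
have -> : pull q (pull (face4 H) Gam) = pull (leg2 H) delta.
  by apply: dual_tens3P => g h x; rewrite !pullE qE !legE.
move=> E; rewrite /twist_form -E pullV // mulrK // pull_unit //.
Qed.

Lemma cocycle_form_twist_datum : twist_datum delta.
Proof.
have Gtw := cocycle_form_twist.
case: Gam_form => Gu Gr Gl _ Ga Gac Gca.
split.
- by rewrite pull_unit.
- move=> h; rewrite pullE legE -unitr_faceE -pullE Gr dual1E.
  by rewrite [LHS]tensor_counitE counit1 mulr1.
- move=> h; rewrite pullE legE -unitl_faceE -pullE Gl dual1E.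
  by rewrite [LHS]tensor_counitE counit1 mulr1.
- apply/twist_act_comm => b.
  have -> : pull (comulop H) b = pull (at_one H) (pull (total_mul H) b).
    by apply: dual_tensP => h g; rewrite !pullE !legE comulopE mulr1.
  exact: pull_comm.
- by apply/twist_act_coact_form; rewrite -Gtw.
- by apply/twist_coact_form; rewrite -Gtw.
Qed.

End AtOne.

End Correspondence.

Theorem proposition5p12 (k : fieldType) (H : hopfAlgType k) :
  [/\ forall delta : dual (H ⊗ H)%type,
        twist_datum delta -> Z2 (B := dual_bcAlg H) (twist_cocycle delta),
      forall delta delta' : dual (H ⊗ H)%type,
        twist_datum delta -> twist_datum delta' ->
        twist_cocycle delta =1 twist_cocycle delta' -> delta = delta'
    & forall gamma : {linear (H ⊗ H)%type -> dual_bcAlg H},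
        Z2 gamma ->
        exists2 delta : dual (H ⊗ H)%type,
          twist_datum delta & twist_cocycle delta =1 gamma].
Proof.
split.
- move=> delta /twist_datum_cocycle_form Gf.
  by apply/(Z2_cocycle_form (twist_cocycle_form delta)).
- move=> delta delta' [du dr dl _ _ _] [du' dr' dl' _ _ _] E.
  rewrite -(twist_form_at_one du dl) -(twist_form_at_one du' dl').
  by congr (pull _ _); apply: dual_tens3P => h g x; rewrite -!twist_cocycle_form E.
- move=> gamma; pose c : {linear (H ⊗ H)%type -> dual H} := gamma.
  have cE h g x : c (h ⊗ g) x = uncurry c (h ⊗ g ⊗ x).
    by rewrite uncurryE //; apply: linE.
  move=> /(Z2_cocycle_form cE) Gf.
  exists (pull (at_one H) (uncurry c)); first exact: cocycle_form_twist_datum.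
  apply: tensor_lin_ext => [||h g]; [exact: linE|exact: linE|].
  apply: dualP => x; rewrite [LHS]twist_cocycle_form -cocycle_form_twist //.
Qed.
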